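(* Let $a$ and $b$ be complex numbers, neither of which is a negative integer, with $\mathrm{Re}(a+b)>0$. Then $$\sum_{n=1}^\infty\frac{\left(\frac12\right)_n(a+b)_n}{(1+a)_n(1+b)_n}H_n=4\sum_{n=1}^\infty\frac{(1-a)_n(1-b)_n}{(1+a)_n(1+b)_n}(-1)^nH_n+{}_3F_2\left({1,\frac12,a+b\atop 1+a,1+b};1\right)\ln 4.$$
   Context: $(x)_n=x(x+1)\cdots(x+n-1)$ is the Pochhammer symbol (with $(x)_0=1$), $H_n=\sum_{k=1}^n\frac1k$ is the $n$-th harmonic number, and ${}_3F_2\left({a_1,a_2,a_3\atop b_1,b_2};z\right)=\sum_{n=0}^\infty\frac{(a_1)_n(a_2)_n(a_3)_n}{n!(b_1)_n(b_2)_n}z^n$. *)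

(* Defs.v *)
From Stdlib Require Import Reals Factorial.
From Coquelicot Require Import Coquelicot.

Fixpoint pochhammer (x : C) (n : nat) : C :=
  match n with
  | O => RtoC 1
  | S m => Cmult (pochhammer x m) (Cplus x (RtoC (INR m)))
  end.

Definition harmonic (n : nat) : R := sum_n_m (fun k => Rinv (INR k)) 1 n.

Definition ex_Cseries (u : nat -> C) : Prop :=
  @ex_series C_AbsRing C_NormedModule u.

(* Coquelicot's [Series] is restricted to real terms. This is the sum of the
   series whenever [ex_Cseries u] holds, and has no meaning otherwise. *)
Definition CSeries (u : nat -> C) : C :=
  (Series (fun n => Re (u n)), Series (fun n => Im (u n))).

Definition hyp3F2_term (a1 a2 a3 b1 b2 z : C) (n : nat) : C :=
  (pochhammer a1 n * pochhammer a2 n * pochhammer a3 n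
   / (RtoC (INR (fact n)) * pochhammer b1 n * pochhammer b2 n) * Cpow z n)%C.

Definition hyp3F2 (a1 a2 a3 b1 b2 z : C) : C :=
  CSeries (hyp3F2_term a1 a2 a3 b1 b2 z).

(* The two harmonic series start at n = 1: as sequences indexed from 0 they
   are used through [fun n => lhs_term a b (S n)], and likewise [rhs_term]. *)
Definition lhs_term (a b : C) (n : nat) : C :=
  (pochhammer (RtoC (1 / 2)) n * pochhammer (a + b) n
   / (pochhammer (1 + a) n * pochhammer (1 + b) n) * RtoC (harmonic n))%C.

Definition rhs_term (a b : C) (n : nat) : C :=
  (pochhammer (1 - a) n * pochhammer (1 - b) n
   / (pochhammer (1 + a) n * pochhammer (1 + b) n)
   * Cpow (RtoC (-1)) n * RtoC (harmonic n))%C.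

(* Main.v *)
Require Import Defs.
From Stdlib Require Import Reals Factorial Lra Lia.
From Coquelicot Require Import Coquelicot.

(** Write beta_r = (-1)^r (1-a)_r (1-b)_r / ((1+a)_r (1+b)_r), let A_n be the
    coefficient (1/2)_n (a+b)_n / ((1+a)_n (1+b)_n) and p_n = (1/2)_n / n!.

    The terminating well-poised 5F4 sum expands A_n over the beta_r,

      A_n = sum_(r <= n) beta_r F(n,r),
      F(n,r) = (2r+1) (1/2)_n n! / ((n-r)! (n+r+1)!),

    where the kernel F is real and free of a and b
    ([hyp_coeff_kernel_transform]).  Exchanging summations, the theorem becomes
    a statement about the columns of the kernel alone:

      sum_n F(n,r) = 2   and   sum_n F(n,r) (H_n - ln 4) = 4 H_r .

    Both follow from a Wilf-Zeilberger pair: F(n,r+1) - F(n,r) is the difference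
    in n of an explicit G(n,r), so from one column to the next the first sum
    changes by a boundary term only, and the second by a boundary term and
    2/(r+1) times the first ([plain_sum_step], [harmonic_sum_step]).  At r = 0
    they reduce to the telescoping sum of 2 (p_n - p_(n+1)) and to
    sum_(k >= 1) p_k / k = ln 4.  The latter is the case s = 1 of
    u(s) = sum_(k >= 1) (1/2)_k / (k (s)_k).  Here u(s) - u(s+1) is a telescoping
    series of sum 1 / (s (2s-1)), and adding these up over s gives twice the
    alternating harmonic series ([lim_sum_over_index]).

    The exchange is delicate, since the series of the beta_r converges only
    conditionally when Re (a+b) is small.  Summing by parts in r replaces
    beta_r by the tails T_r of its series and the truncated column sum f_N(r) by
    its increment in r.  The closed form of G gives
    |f_N(r+1) - f_N(r)| <= 40 (1 + H_r) / (r+1) uniformly in N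
    ([harmonic_sum_step_bound]), while |T_r| is at most a constant times
    exp (- d H_r) with d = Re (a+b) > 0 ([alternating_tails]).  The product is
    summable uniformly in N, so Tannery's theorem applies
    ([lim_sum_kernel_transform]).  Every convergence claim of the theorem comes
    out of the same argument ([harmonic_summation]). *)

Local Open Scope R_scope.

(** * Harmonic numbers *)

Lemma sum_SnR (f : nat -> R) (n : nat) : sum_n f (S n) = sum_n f n + f (S n).
Proof. exact (sum_Sn f n). Qed.

Lemma harmonic_S (n : nat) : harmonic (S n) = harmonic n + / (INR n + 1).
Proof.
  unfold harmonic. rewrite sum_n_Sm by lia. rewrite <- S_INR. reflexivity.
Qed.

Lemma harmonic_0 : harmonic 0 = 0.
Proof. unfold harmonic. now rewrite sum_n_m_zero by lia. Qed.

Lemma harmonic_ge_0 (n : nat) : 0 <= harmonic n.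
Proof.
  induction n as [|n IH]; [rewrite harmonic_0; lra|].
  rewrite harmonic_S. pose proof (pos_INR n) as Hn.
  assert (0 < / (INR n + 1)) by (apply Rinv_0_lt_compat; lra). lra.
Qed.

Lemma ln_le_pred (x : R) : 0 < x -> ln x <= x - 1.
Proof.
  intros Hx. pose proof (exp_ineq1_le (ln x)) as H.
  rewrite exp_ln in H by exact Hx. lra.
Qed.

Lemma ln_succ_bounds (x : R) :
  0 < x -> / (x + 1) <= ln (x + 1) - ln x <= / x.
Proof.
  intros Hx. split.
  - pose proof (ln_le_pred (x / (x + 1))) as H.
    rewrite ln_div in H by lra.
    assert (0 < x / (x + 1)) by (apply Rdiv_lt_0_compat; lra).
    replace (x / (x + 1) - 1) with (- / (x + 1)) in H by (field; lra).
    specialize (H ltac:(assumption)). lra.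
  - pose proof (ln_le_pred ((x + 1) / x)) as H.
    rewrite ln_div in H by lra.
    assert (0 < (x + 1) / x) by (apply Rdiv_lt_0_compat; lra).
    replace ((x + 1) / x - 1) with (/ x) in H by (field; lra).
    specialize (H ltac:(assumption)). lra.
Qed.

Lemma harmonic_ln_bounds (n : nat) :
  ln (INR n + 1) <= harmonic n <= 1 + ln (INR n + 1).
Proof.
  assert (H : ln (INR n + 1) <= harmonic n
              <= 1 + ln (INR n + 1) - / (INR n + 1)).
  { induction n as [|n IH].
    - rewrite harmonic_0. simpl INR. rewrite Rplus_0_l, ln_1. lra.
    - rewrite harmonic_S, S_INR. pose proof (pos_INR n) as Hn.
      pose proof (ln_succ_bounds (INR n + 1) ltac:(lra)). lra. }
  pose proof (pos_INR n) as Hn.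
  assert (0 < / (INR n + 1)) by (apply Rinv_0_lt_compat; lra). lra.
Qed.

(** * The series for ln 4 *)

(** (1/2)_n / (s)_n. *)
Fixpoint half_ratio (s n : nat) : R :=
  match n with
  | O => 1
  | S k => half_ratio s k * (INR k + 1 / 2) / (INR s + INR k)
  end.

(** p_n = (1/2)_n / n!, the normalised central binomial coefficient. *)
Local Notation central n := (half_ratio 1 n).

Lemma half_ratio_S (s n : nat) :
  half_ratio s (S n) = half_ratio s n * (INR n + 1 / 2) / (INR s + INR n).
Proof. reflexivity. Qed.

Lemma half_ratio_ge_0 (s n : nat) : (1 <= s)%nat -> 0 <= half_ratio s n.
Proof.
  intros Hs. apply le_INR in Hs. simpl in Hs.
  induction n as [|n IH]; [simpl; lra|]. rewrite half_ratio_S.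
  pose proof (pos_INR n).
  apply Rdiv_le_0_compat; [apply Rmult_le_pos|]; lra.
Qed.

Lemma half_ratio_shift (s n : nat) :
  (1 <= s)%nat ->
  half_ratio s n * INR s = half_ratio (S s) n * (INR s + INR n).
Proof.
  intros Hs. apply le_INR in Hs. simpl in Hs.
  induction n as [|n IH]; [simpl; ring|].
  rewrite !half_ratio_S, !S_INR. pose proof (pos_INR n).
  replace (half_ratio s n * (INR n + 1 / 2) / (INR s + INR n) * INR s)
    with (half_ratio s n * INR s * (INR n + 1 / 2) / (INR s + INR n))
    by (field; lra).
  rewrite IH. field. lra.
Qed.

(** Telescoping: (1/2)_k / (s+1)_k is, up to the factor s - 1/2, the difference
    of two consecutive values of s (1/2)_k / (s)_k. *)
Lemma half_ratio_sum_shift (s n : nat) :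
  (1 <= s)%nat ->
  sum_n (half_ratio (S s)) n * (INR s - 1 / 2)
  = INR s * (1 - half_ratio s (S n)) .
Proof.
  intros Hs. pose proof (le_INR _ _ Hs) as Hs'. simpl in Hs'.
  assert (Hstep : forall k, half_ratio (S s) k * (INR s - 1 / 2)
            = INR s * half_ratio s k - INR s * half_ratio s (S k)).
  { intros k. rewrite half_ratio_S. pose proof (half_ratio_shift s k Hs) as H.
    pose proof (pos_INR k).
    apply (Rmult_eq_reg_r (INR s + INR k)); [|lra].
    transitivity ((half_ratio (S s) k * (INR s + INR k)) * (INR s - 1/2)); [ring|].
    rewrite <- H. field. lra. }
  induction n as [|n IH].
  - rewrite sum_O, Hstep. simpl. lra.
  - rewrite sum_SnR, Rmult_plus_distr_r, IH, Hstep. ring.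
Qed.

Lemma half_ratio_le_central (s n : nat) :
  (1 <= s)%nat -> half_ratio s n <= central n.
Proof.
  intros Hs. pose proof (le_INR _ _ Hs) as Hs'. simpl in Hs'.
  induction n as [|n IH]; [simpl; lra|].
  rewrite !half_ratio_S. pose proof (pos_INR n). unfold Rdiv.
  pose proof (half_ratio_ge_0 s n Hs).
  apply Rmult_le_compat.
  - apply Rmult_le_pos; lra.
  - apply Rlt_le, Rinv_0_lt_compat; lra.
  - apply Rmult_le_compat_r; lra.
  - apply Rinv_le_contravar; simpl INR; lra.
Qed.

(** The partial sum over 1 <= k <= n+1 of (1/2)_k / (k (s)_k); its limit is
    psi(s) - psi(s - 1/2), psi being the digamma function. *)
Definition sum_over_index (s n : nat) : R :=
  sum_n (fun k => half_ratio s (S k) / (INR k + 1)) n.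

(** 1/(s)_k - 1/(s+1)_k = k / (s (s+1)_k) cancels the denominator k, and what
    is left is summed by [half_ratio_sum_shift]. *)
Lemma sum_over_index_shift (s n : nat) :
  (1 <= s)%nat ->
  sum_over_index s n - sum_over_index (S s) n
  = / (INR s * (2 * INR s - 1)) - half_ratio s (S (S n)) / (INR s - 1 / 2).
Proof.
  intros Hs. pose proof (le_INR _ _ Hs) as Hs'. simpl in Hs'.
  pose proof (half_ratio_sum_shift s (S n) Hs) as Hsum.
  assert (H : INR s * (sum_over_index s n - sum_over_index (S s) n)
              = sum_n (half_ratio (S s)) (S n) - 1).
  { clear Hsum. unfold sum_over_index.
    assert (Hk : forall k, INR s * (half_ratio s (S k) / (INR k + 1)
              - half_ratio (S s) (S k) / (INR k + 1)) = half_ratio (S s) (S k)).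
    { intros k. pose proof (half_ratio_shift s (S k) Hs) as H.
      rewrite S_INR in H. pose proof (pos_INR k).
      apply (Rmult_eq_reg_r (INR k + 1)); [|lra].
      field_simplify; [|lra]. lra. }
    induction n as [|n IH].
    - rewrite sum_SnR, !sum_O, Hk. simpl (half_ratio (S s) 0). ring.
    - rewrite (sum_SnR _ (S n)), !(sum_SnR _ n). rewrite (sum_SnR _ n) in IH.
      pose proof (Hk (S n)) as E. cbv beta. lra. }
  apply (Rmult_eq_reg_l (INR s * (INR s - 1/2))).
  2:{ apply Rgt_not_eq. nra. }
  transitivity
    (INR s * (sum_over_index s n - sum_over_index (S s) n) * (INR s - 1/2));
    [ring|].
  rewrite H, Rmult_minus_distr_r, Hsum. field. lra.
Qed.

Lemma sum_over_index_bound (s n : nat) :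
  (1 <= s)%nat -> 0 <= sum_over_index (S s) n <= / INR s + / INR s.
Proof.
  intros Hs. pose proof (le_INR _ _ Hs) as Hs'. simpl in Hs'.
  assert (Hle : 0 <= sum_over_index (S s) n <= sum_n (half_ratio (S s)) (S n) - 1).
  { unfold sum_over_index.
    assert (Hk : forall k,
      0 <= half_ratio (S s) (S k) / (INR k + 1) <= half_ratio (S s) (S k)).
    { intros k. pose proof (half_ratio_ge_0 (S s) (S k) ltac:(lia)).
      pose proof (pos_INR k). split.
      - apply Rdiv_le_0_compat; lra.
      - apply Rle_div_l; [lra|]. nra. }
    induction n as [|n IH].
    - rewrite sum_SnR, !sum_O. pose proof (Hk O). simpl (half_ratio (S s) 0). lra.
    - rewrite (sum_SnR _ (S n)), (sum_SnR _ n). pose proof (Hk (S n)). lra. }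
  pose proof (half_ratio_sum_shift s (S n) Hs) as Hsum.
  pose proof (half_ratio_ge_0 s (S (S n)) Hs).
  assert (sum_n (half_ratio (S s)) (S n) - 1 <= / INR s + / INR s).
  { apply (Rmult_le_reg_r (INR s - 1/2)); [lra|].
    rewrite Rmult_minus_distr_r, Hsum.
    replace ((/ INR s + / INR s) * (INR s - 1/2)) with (2 - / INR s) by (field; lra).
    assert (/ INR s <= 1) by (rewrite <- Rinv_1; apply Rinv_le_contravar; lra).
    nra. }
  lra.
Qed.

(** Wallis-type bound: p_(n+1)/p_n = (2n+1)/(2n+2), whose square is at most
    (2n+1)/(2n+3). *)
Lemma central_sqr_bound (n : nat) : central n * central n * (2 * INR n + 1) <= 1.
Proof.
  induction n as [|n IH]; [simpl; lra|].
  rewrite half_ratio_S, (S_INR n). pose proof (pos_INR n). simpl (INR 1).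
  set (p := central n) in *. set (x := INR n) in *.
  replace (p * (x + 1/2) / (1 + x) * (p * (x + 1/2) / (1 + x)) * (2 * (x + 1) + 1))
    with (p * p * (2 * x + 1) * ((2 * x + 1) * (2 * x + 3) / (4 * (1 + x) * (1 + x))))
    by (field; lra).
  assert (0 <= (2 * x + 1) * (2 * x + 3) / (4 * (1 + x) * (1 + x)) <= 1).
  { split; [apply Rdiv_le_0_compat; nra|]. apply Rle_div_l; nra. }
  assert (0 <= p * p * (2 * x + 1)) by nra.
  apply Rle_trans with (p * p * (2 * x + 1) * 1); [|lra].
  apply Rmult_le_compat_l; lra.
Qed.

Lemma central_le_sqrt (n : nat) : central n <= / sqrt (INR n + 1).
Proof.
  pose proof (central_sqr_bound n) as H. pose proof (pos_INR n).
  pose proof (half_ratio_ge_0 1 n ltac:(lia)) as Hp.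
  assert (Hy : 0 < sqrt (INR n + 1)) by (apply sqrt_lt_R0; lra).
  pose proof (sqrt_sqrt (INR n + 1) ltac:(lra)) as Hs.
  set (y := sqrt (INR n + 1)) in *. set (p := central n) in *.
  apply (Rmult_le_reg_r y); [lra|]. rewrite Rinv_l by lra.
  assert (p * p * (y * y) <= 1) by (rewrite Hs; nra).
  nra.
Qed.

(** From H_n <= 1 + ln (n+1) and ln y <= ln m + (y/m - 1) at y = sqrt (n+1).  The
    free scale m separates the growth of H_n up to n = m^2 from the growth beyond. *)
Lemma harmonic_le_sqrt (n : nat) (m : R) :
  0 < m -> harmonic n <= 1 + 2 * ln m + 2 * (sqrt (INR n + 1) / m).
Proof.
  intros Hm. pose proof (pos_INR n).
  assert (Hy : 0 < sqrt (INR n + 1)) by (apply sqrt_lt_R0; lra).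
  pose proof (harmonic_ln_bounds n) as [_ Hh].
  rewrite <- (sqrt_sqrt (INR n + 1)) in Hh by lra.
  rewrite ln_mult in Hh by exact Hy.
  pose proof (ln_le_pred (sqrt (INR n + 1) / m)) as Hl.
  rewrite ln_div in Hl by lra.
  specialize (Hl (Rdiv_lt_0_compat _ _ Hy Hm)). lra.
Qed.

Lemma lim_inv_succ : is_lim_seq (fun n => / (INR n + 1)) 0.
Proof.
  apply (is_lim_seq_inv _ p_infty); [|discriminate].
  apply is_lim_seq_ext with (fun n => INR (S n)).
  - intros n. apply S_INR.
  - apply (is_lim_seq_incr_1 INR), is_lim_seq_INR.
Qed.

Lemma lim_inv_sqrt_succ : is_lim_seq (fun n => / sqrt (INR n + 1)) 0.
Proof.
  apply is_lim_seq_ext with (fun n => sqrt (/ (INR n + 1))).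
  - intros n. apply sqrt_inv.
  - rewrite <- sqrt_0. apply is_lim_seq_continuous; [|apply lim_inv_succ].
    apply continuity_pt_sqrt. lra.
Qed.

Lemma lim_central : is_lim_seq (fun n => central n) 0.
Proof.
  apply is_lim_seq_le_le with (fun _ => 0) (fun n => / sqrt (INR n + 1)).
  - intros n. split; [apply half_ratio_ge_0; lia|apply central_le_sqrt].
  - apply is_lim_seq_const.
  - apply lim_inv_sqrt_succ.
Qed.

Lemma lim_central_harmonic : is_lim_seq (fun n => central n * harmonic n) 0.
Proof.
  apply is_lim_seq_le_le with (fun _ => 0)
    (fun n => / sqrt (INR n + 1) + 4 * sqrt (/ sqrt (INR n + 1))).
  - intros n. pose proof (pos_INR n) as Hn.
    pose proof (half_ratio_ge_0 1 n ltac:(lia)) as Hp.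
    pose proof (harmonic_ge_0 n) as Hh.
    split; [now apply Rmult_le_pos|].
    assert (Hy : 0 < sqrt (INR n + 1)) by (apply sqrt_lt_R0; lra).
    set (y := sqrt (INR n + 1)) in *.
    assert (Hz : 0 < sqrt y) by (apply sqrt_lt_R0; lra).
    pose proof (sqrt_sqrt y ltac:(lra)) as Hzz.
    pose proof (harmonic_le_sqrt n (sqrt y) Hz) as H1. fold y in H1.
    pose proof (ln_le_pred (sqrt y) Hz) as H2.
    rewrite sqrt_inv. set (z := sqrt y) in *.
    replace (y / z) with z in H1 by (rewrite <- Hzz; field; lra).
    apply Rle_trans with (/ y * (1 + 4 * z)).
    + apply Rmult_le_compat; try lra. apply central_le_sqrt.
    + rewrite <- Hzz. apply Req_le. field. lra.
  - apply is_lim_seq_const.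
  - replace (Finite 0) with (Finite (0 + 4 * sqrt 0))
      by (f_equal; rewrite sqrt_0; ring).
    apply is_lim_seq_plus'; [apply lim_inv_sqrt_succ|].
    apply (is_lim_seq_scal_l _ 4 (sqrt 0)).
    apply is_lim_seq_continuous; [|apply lim_inv_sqrt_succ].
    apply continuity_pt_sqrt. lra.
Qed.

Lemma harmonic_double_bounds (n m : nat) :
  harmonic (S n + m) - harmonic (S n)
  <= ln (INR (S n + m)) - ln (INR (S n))
  <= harmonic (S n + m) - harmonic (S n) + / INR (S n) - / INR (S n + m).
Proof.
  induction m as [|m IH].
  - rewrite Nat.add_0_r. lra.
  - rewrite Nat.add_succ_r, harmonic_S, (S_INR (S n + m)).
    assert (0 < INR (S n + m)) by (apply lt_0_INR; lia).
    pose proof (ln_succ_bounds (INR (S n + m)) ltac:(assumption)). lra.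
Qed.

Lemma sum_inv_pairs (n : nat) :
  sum_n (fun k => / (INR (S k) * (2 * INR (S k) - 1))) n
  = 2 * (harmonic (S n + S n) - harmonic (S n)) :> R.
Proof.
  induction n as [|n IH].
  - rewrite sum_O. change (1 + 1)%nat with 2%nat.
    rewrite !harmonic_S, harmonic_0. simpl. field.
  - rewrite sum_SnR, IH.
    replace (S (S n) + S (S n))%nat with (S (S (S n + S n))) by lia.
    rewrite !harmonic_S, !S_INR, plus_INR, !S_INR. pose proof (pos_INR n).
    field. lra.
Qed.

(** 1/(k(2k-1)) = 2 (1/(2k-1) - 1/(2k)): twice the alternating harmonic series. *)
Lemma lim_sum_inv_pairs :
  is_lim_seq (sum_n (fun k => / (INR (S k) * (2 * INR (S k) - 1)))) (ln 4).
Proof.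
  apply is_lim_seq_le_le with (fun n => ln 4 - 2 * / (INR n + 1)) (fun _ => ln 4).
  - intros n. rewrite sum_inv_pairs.
    pose proof (harmonic_double_bounds n (S n)) as H.
    assert (Hn : 0 < INR (S n)) by (apply lt_0_INR; lia).
    rewrite (plus_INR (S n) (S n)) in H.
    replace (INR (S n) + INR (S n)) with (2 * INR (S n)) in H by ring.
    rewrite ln_mult in H by lra.
    replace 4 with (2 * 2) by ring. rewrite ln_mult by lra.
    rewrite <- S_INR.
    assert (0 < / (2 * INR (S n))) by (apply Rinv_0_lt_compat; lra). lra.
  - replace (Finite (ln 4)) with (Finite (ln 4 - 2 * 0)) by (f_equal; ring).
    apply is_lim_seq_minus'; [apply is_lim_seq_const|].
    apply (is_lim_seq_scal_l _ 2 0), lim_inv_succ.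
  - apply is_lim_seq_const.
Qed.

(** Shifting s up to n+2 while k runs up to n+1 costs two errors: the truncation
    terms, at most 2 p_(n+2) H_(n+1) in total, and the remaining sum at s = n+2,
    at most 2/(n+1). *)
Lemma lim_sum_over_index : is_lim_seq (sum_over_index 1) (ln 4).
Proof.
  assert (Htel : forall n m,
    0 <= sum_n (fun k => / (INR (S k) * (2 * INR (S k) - 1))) m
         - (sum_over_index 1 n - sum_over_index (S (S m)) n)
      <= 2 * (central (S (S n)) * harmonic (S m))).
  { intros n m. induction m as [|m IH].
    - rewrite sum_O, sum_over_index_shift, harmonic_S, harmonic_0 by lia.
      pose proof (half_ratio_ge_0 1 (S (S n)) ltac:(lia)).
      cbn [INR]. rewrite Rplus_0_l, Rplus_0_l, Rinv_1.
      replace (central (S (S n)) / (1 - 1 / 2)) with (2 * central (S (S n))) by field.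
      lra.
    - rewrite sum_SnR, harmonic_S.
      pose proof (sum_over_index_shift (S (S m)) n ltac:(lia)) as H.
      pose proof (half_ratio_ge_0 (S (S m)) (S (S n)) ltac:(lia)) as H0.
      pose proof (half_ratio_le_central (S (S m)) (S (S n)) ltac:(lia)) as H1.
      rewrite <- (S_INR (S m)).
      assert (Hm : 1 <= INR (S (S m))) by (apply (le_INR 1); lia).
      assert (0 <= half_ratio (S (S m)) (S (S n)) / (INR (S (S m)) - 1/2)
               <= 2 * (central (S (S n)) * / INR (S (S m)))).
      { split; [apply Rdiv_le_0_compat; lra|].
        apply Rle_div_l; [lra|].
        replace (2 * (central (S (S n)) * / INR (S (S m))) * (INR (S (S m)) - 1 / 2))
          with (central (S (S n)) * (2 - / INR (S (S m)))) by (field; lra).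
        assert (/ INR (S (S m)) <= 1)
          by (rewrite <- Rinv_1; apply Rinv_le_contravar; lra).
        nra. }
      lra. }
  set (a := fun n : nat => sum_n (fun k => / (INR (S k) * (2 * INR (S k) - 1))) n).
  apply is_lim_seq_le_le with
    (fun n => a n - 2 * (central (S (S n)) * harmonic (S (S n))))
    (fun n => a n + 2 * / (INR n + 1)).
  - intros n. specialize (Htel n n). fold (a n) in Htel.
    pose proof (sum_over_index_bound (S n) n ltac:(lia)) as Hb.
    rewrite S_INR in Hb.
    assert (central (S (S n)) * harmonic (S n)
            <= central (S (S n)) * harmonic (S (S n))).
    { apply Rmult_le_compat_l; [apply half_ratio_ge_0; lia|].
      rewrite (harmonic_S (S n)). pose proof (pos_INR (S n)).
      assert (0 < / (INR (S n) + 1)) by (apply Rinv_0_lt_compat; lra). lra. }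
    lra.
  - replace (Finite (ln 4)) with (Finite (ln 4 - 2 * 0)) by (f_equal; ring).
    apply is_lim_seq_minus'; [apply lim_sum_inv_pairs|].
    apply (is_lim_seq_scal_l _ 2 0).
    pose proof (proj1 (is_lim_seq_incr_n (fun n => central n * harmonic n) 2 0)
                  lim_central_harmonic) as H.
    revert H. apply is_lim_seq_ext. intros n.
    now replace (n + 2)%nat with (S (S n)) by lia.
  - replace (Finite (ln 4)) with (Finite (ln 4 + 2 * 0)) by (f_equal; ring).
    apply is_lim_seq_plus'; [apply lim_sum_inv_pairs|].
    apply (is_lim_seq_scal_l _ 2 0), lim_inv_succ.
Qed.

(** * The kernel and its telescoping certificate *)

(** n! (n+1)! / ((n-r)! (n+r+1)!), which vanishes for r > n.  The product form
    avoids factorials of truncated differences, and makes the recurrences in n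
    and r hold with no condition on r. *)
Fixpoint falling_ratio (n r : nat) : R :=
  match r with
  | O => 1
  | S k => falling_ratio n k * (INR n - INR k) / (INR n + INR k + 2)
  end.

Lemma falling_ratio_S (n r : nat) :
  falling_ratio n (S r)
  = falling_ratio n r * (INR n - INR r) / (INR n + INR r + 2).
Proof. reflexivity. Qed.

Lemma falling_ratio_gt (n r : nat) : (n < r)%nat -> falling_ratio n r = 0.
Proof.
  intros H. induction r as [|r IH]; [lia|]. rewrite falling_ratio_S.
  destruct (Nat.eq_dec r n) as [->|Hne].
  - rewrite Rminus_diag. unfold Rdiv. ring.
  - rewrite IH by lia. unfold Rdiv. ring.
Qed.

Lemma falling_ratio_ge_0 (n r : nat) : 0 <= falling_ratio n r.
Proof.
  destruct (Nat.lt_ge_cases n r) as [H|H].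
  - rewrite falling_ratio_gt by exact H. lra.
  - induction r as [|r IH]; [simpl; lra|]. rewrite falling_ratio_S.
    specialize (IH ltac:(lia)). apply le_INR in H. rewrite S_INR in H.
    pose proof (pos_INR n). pose proof (pos_INR r).
    apply Rdiv_le_0_compat; [apply Rmult_le_pos|]; lra.
Qed.

Lemma falling_ratio_succ_l (n r : nat) :
  falling_ratio n r * ((INR n + 1) * (INR n + 2))
  = falling_ratio (S n) r * ((INR n + 1 - INR r) * (INR n + INR r + 2)).
Proof.
  pose proof (pos_INR n).
  induction r as [|r IH].
  - simpl falling_ratio. simpl (INR 0). ring.
  - pose proof (pos_INR r). rewrite !falling_ratio_S, !S_INR.
    transitivity (falling_ratio n r * ((INR n + 1) * (INR n + 2))
      * ((INR n - INR r) / (INR n + INR r + 2))); [field; lra|].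
    rewrite IH. field. lra.
Qed.

(** A rational substitute for the Gaussian profile exp (- r^2 / n). *)
Lemma falling_ratio_decay (n r : nat) :
  falling_ratio n r * (INR n + 1 + INR r * (INR r + 1)) <= INR n + 1.
Proof.
  pose proof (pos_INR n) as Hn.
  destruct (Nat.lt_ge_cases n r) as [H|H].
  - rewrite falling_ratio_gt by exact H. lra.
  - induction r as [|r IH]; [simpl; lra|]. rewrite falling_ratio_S.
    specialize (IH ltac:(lia)). apply le_INR in H. rewrite S_INR in *.
    pose proof (pos_INR r). pose proof (falling_ratio_ge_0 n r) as Hq.
    set (q := falling_ratio n r) in *. set (x := INR n) in *. set (y := INR r) in *.
    apply Rle_trans with (q * (x + 1 + y * (y + 1))); [|exact IH].
    replace (q * (x - y) / (x + y + 2) * (x + 1 + (y + 1) * (y + 1 + 1)))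
      with (q * ((x - y) * (x + 1 + (y + 1) * (y + 1 + 1)) / (x + y + 2)))
      by (field; lra).
    apply Rmult_le_compat_l; [exact Hq|].
    apply Rle_div_l; [lra|].
    assert (0 <= (y + 1) * (y + 1) * (y + 1)) by (apply Rmult_le_pos; nra).
    nra.
Qed.

Lemma falling_ratio_le_1 (n r : nat) : falling_ratio n r <= 1.
Proof.
  pose proof (falling_ratio_decay n r) as H. pose proof (pos_INR n).
  pose proof (pos_INR r). pose proof (falling_ratio_ge_0 n r) as Hq.
  apply (Rmult_le_reg_r (INR n + 1)); [lra|].
  assert (0 <= falling_ratio n r * (INR r * (INR r + 1)))
    by (apply Rmult_le_pos; nra).
  lra.
Qed.

(** F(n,r) = (2r+1) (1/2)_n n! / ((n-r)! (n+r+1)!). *)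
Definition kernel (n r : nat) : R :=
  (2 * INR r + 1) * (central n / (INR n + 1)) * falling_ratio n r.

(** The Wilf-Zeilberger mate G(n,r) = -4 (1/2)_n n! / ((n-1-r)! (n+r+1)!) of
    [kernel]. *)
Definition certificate (n r : nat) : R :=
  - 4 * (INR n - INR r) * (central n / (INR n + 1)) * falling_ratio n r.

Lemma kernel_gt (n r : nat) : (n < r)%nat -> kernel n r = 0.
Proof. intros H. unfold kernel. rewrite falling_ratio_gt by exact H. ring. Qed.

Lemma kernel_ge_0 (n r : nat) : 0 <= kernel n r.
Proof.
  unfold kernel. pose proof (pos_INR n). pose proof (pos_INR r).
  pose proof (half_ratio_ge_0 1 n ltac:(lia)).
  apply Rmult_le_pos; [|apply falling_ratio_ge_0].
  apply Rmult_le_pos; [lra|]. apply Rdiv_le_0_compat; lra.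
Qed.

Lemma certificate_0_l (r : nat) : certificate 0 r = 0.
Proof.
  unfold certificate. destruct r as [|r].
  - simpl. ring.
  - rewrite falling_ratio_gt by lia. ring.
Qed.

Lemma certificate_bounds (n r : nat) :
  0 <= - certificate n r <= 4 * (central n * falling_ratio n r).
Proof.
  unfold certificate. pose proof (pos_INR n) as Hn. pose proof (pos_INR r) as Hr.
  pose proof (half_ratio_ge_0 1 n ltac:(lia)) as Hp.
  pose proof (falling_ratio_ge_0 n r) as Hq.
  destruct (Nat.lt_ge_cases n r) as [H|H].
  - rewrite falling_ratio_gt by exact H. lra.
  - apply le_INR in H.
    set (q := falling_ratio n r) in *. set (x := INR n) in *. set (y := INR r) in *.
    set (p := central n) in *.
    replace (- (-4 * (x - y) * (p / (x + 1)) * q))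
      with (4 * (p * q) * ((x - y) / (x + 1))) by (field; lra).
    assert (0 <= p * q) by (apply Rmult_le_pos; lra).
    assert (0 <= (x - y) / (x + 1) <= 1).
    { split; [apply Rdiv_le_0_compat; lra|]. apply Rle_div_l; lra. }
    split; [apply Rmult_le_pos; lra|].
    apply Rle_trans with (4 * (p * q) * 1); [|lra].
    apply Rmult_le_compat_l; lra.
Qed.

Lemma certificate_succ_l (n r : nat) :
  certificate (S n) r
  = - 4 * (INR n + 1 / 2) / (INR n + INR r + 2) * central n * falling_ratio n r.
Proof.
  pose proof (pos_INR n). pose proof (pos_INR r).
  pose proof (falling_ratio_succ_l n r) as E.
  unfold certificate. rewrite half_ratio_S, (S_INR n). simpl (INR 1).
  transitivity (-4 * (INR n + 1/2) / (INR n + INR r + 2) * central n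
    / ((INR n + 1) * (INR n + 2))
    * (falling_ratio (S n) r * ((INR n + 1 - INR r) * (INR n + INR r + 2)))).
  - field. lra.
  - rewrite <- E. field. lra.
Qed.

Lemma kernel_0_r (n : nat) : kernel n 0 = 2 * central n - 2 * central (S n).
Proof.
  unfold kernel. rewrite half_ratio_S. simpl (falling_ratio n 0).
  simpl (INR 0). simpl (INR 1). pose proof (pos_INR n). field. lra.
Qed.

Lemma kernel_succ_r (n r : nat) :
  kernel n (S r) - kernel n r = certificate (S n) r - certificate n r.
Proof.
  pose proof (pos_INR n). pose proof (pos_INR r).
  rewrite certificate_succ_l. unfold kernel, certificate.
  rewrite falling_ratio_S, (S_INR r). field. lra.
Qed.

(** What differentiation at e = 1 adds to [kernel_succ_r], for the deformation
    (2r+1) (1/2)_n (e)_n (2-e)_r / ((n-r)! (n+r+1)! (e)_r) of the kernel, whose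
    column sums are also constant.  This is how harmonic numbers enter. *)
Lemma kernel_add_succ_r (n r : nat) :
  (kernel n (S r) + kernel n r) / (INR r + 1)
  = - (certificate (S n) r / (INR n + 1)).
Proof.
  pose proof (pos_INR n). pose proof (pos_INR r).
  rewrite certificate_succ_l. unfold kernel.
  rewrite falling_ratio_S, (S_INR r). field. lra.
Qed.

(** The truncated column sum f_N(r) for the weight w. *)
Definition weighted_sum (w : nat -> R) (N r : nat) : R :=
  sum_n (fun n => kernel n r * w n) N.

Lemma weighted_sum_S (w : nat -> R) (N r : nat) :
  weighted_sum w (S N) r = weighted_sum w N r + kernel (S N) r * w (S N).
Proof. apply sum_SnR. Qed.

Lemma weighted_sum_gt (w : nat -> R) (N r : nat) :
  (N < r)%nat -> weighted_sum w N r = 0.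
Proof.
  induction N as [|N IH]; intros H.
  - unfold weighted_sum. rewrite sum_O, kernel_gt by exact H. ring.
  - rewrite weighted_sum_S, IH, kernel_gt by lia. ring.
Qed.

Local Notation plain := (fun _ : nat => 1).

Lemma plain_sum_step (N r : nat) :
  weighted_sum plain N (S r) - weighted_sum plain N r = certificate (S N) r.
Proof.
  induction N as [|N IH].
  - unfold weighted_sum. rewrite !sum_O. pose proof (kernel_succ_r 0 r) as H.
    rewrite certificate_0_l in H. lra.
  - rewrite !weighted_sum_S. pose proof (kernel_succ_r (S N) r) as H. lra.
Qed.

Lemma plain_sum_0 (N : nat) : weighted_sum plain N 0 = 2 - 2 * central (S N).
Proof.
  induction N as [|N IH].
  - unfold weighted_sum. rewrite sum_O, kernel_0_r. simpl (central 0). ring.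
  - rewrite weighted_sum_S, IH, kernel_0_r. ring.
Qed.

Lemma plain_sum_bounds (N r : nat) : 0 <= weighted_sum plain N r <= 2.
Proof.
  split.
  - induction N as [|N IH].
    + unfold weighted_sum. rewrite sum_O. pose proof (kernel_ge_0 0 r). lra.
    + rewrite weighted_sum_S. pose proof (kernel_ge_0 (S N) r). lra.
  - induction r as [|r IH].
    + rewrite plain_sum_0. pose proof (half_ratio_ge_0 1 (S N) ltac:(lia)). lra.
    + pose proof (plain_sum_step N r). pose proof (certificate_bounds (S N) r). lra.
Qed.

Definition shifted_harmonic (n : nat) : R := harmonic n - ln 4.

Lemma harmonic_sum_step (N r : nat) :
  weighted_sum shifted_harmonic N (S r) - weighted_sum shifted_harmonic N r
  = certificate (S N) r * (shifted_harmonic (S N) - / (INR r + 1))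
    + 2 / (INR r + 1) * weighted_sum plain N (S r).
Proof.
  assert (Hr : / (INR r + 1) <> 0).
  { pose proof (pos_INR r). apply Rinv_neq_0_compat. lra. }
  assert (Hstep : forall n, (kernel n (S r) - kernel n r) * shifted_harmonic n
    = certificate (S n) r * (shifted_harmonic (S n) - / (INR r + 1))
      - certificate n r * (shifted_harmonic n - / (INR r + 1))
      + 2 / (INR r + 1) * kernel n (S r)).
  { intros n. pose proof (kernel_succ_r n r) as H1.
    pose proof (kernel_add_succ_r n r) as H2.
    unfold shifted_harmonic. rewrite harmonic_S.
    unfold Rdiv in *.
    replace (certificate n r)
      with (certificate (S n) r - (kernel n (S r) - kernel n r)) by lra.
    nra. }
  induction N as [|N IH].
  - unfold weighted_sum. rewrite !sum_O. pose proof (Hstep O) as H.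
    rewrite certificate_0_l in H. lra.
  - rewrite !weighted_sum_S. pose proof (Hstep (S N)) as H. nra.
Qed.

(** At r = 0 the kernel is 2 (p_n - p_(n+1)), so summation by parts moves the
    difference onto H_n and leaves the sum of p_k / k. *)
Lemma harmonic_sum_0 (N : nat) :
  weighted_sum shifted_harmonic (S N) 0
  = 2 * sum_over_index 1 N - 2 * (central (S (S N)) * harmonic (S N))
    - ln 4 * weighted_sum plain (S N) 0.
Proof.
  unfold sum_over_index, shifted_harmonic.
  induction N as [|N IH].
  - rewrite !weighted_sum_S, sum_O. unfold weighted_sum. rewrite !sum_O, !kernel_0_r.
    rewrite harmonic_S, harmonic_0. simpl (INR 0). rewrite !Rplus_0_l.
    unfold Rdiv. rewrite !Rinv_1. ring.
  - rewrite weighted_sum_S, IH, (weighted_sum_S plain (S N)), sum_SnR, kernel_0_r.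
    rewrite (harmonic_S (S N)). unfold Rdiv. ring.
Qed.


(** With y = sqrt (n+1) and m = r+1 the product is at most
    2y / (y^2 + m^2) <= 1/m; the growth of H_n beyond scale m^2, at most 2y/m, is
    absorbed by the same fraction.  Nothing depends on n, which is what uniform
    domination requires. *)
Lemma central_falling_ratio_bound (n r : nat) :
  central n * falling_ratio n r <= / (INR r + 1)
  /\ central n * falling_ratio n r * harmonic n
     <= (5 + 2 * harmonic r) / (INR r + 1).
Proof.
  pose proof (pos_INR n) as Hn. pose proof (pos_INR r) as Hr.
  assert (Hy : 0 < sqrt (INR n + 1)) by (apply sqrt_lt_R0; lra).
  pose proof (sqrt_sqrt (INR n + 1) ltac:(lra)) as Hyy.
  pose proof (central_le_sqrt n) as Hp.
  pose proof (half_ratio_ge_0 1 n ltac:(lia)) as Hp0.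
  pose proof (falling_ratio_ge_0 n r) as Hq0.
  pose proof (falling_ratio_decay n r) as Hq.
  pose proof (harmonic_le_sqrt n (INR r + 1) ltac:(lra)) as Hh.
  pose proof (harmonic_ge_0 n) as Hh0.
  pose proof (proj1 (harmonic_ln_bounds r)) as Hl.
  set (y := sqrt (INR n + 1)) in *. set (m := INR r + 1) in *.
  assert (Hm : 1 <= m) by (unfold m; lra).
  set (q := falling_ratio n r) in *. set (p := central n) in *.
  assert (Hden : 0 < y * y + m * m) by nra.
  assert (H : p * q <= 2 * y / (y * y + m * m)).
  { replace (2 * y / (y * y + m * m))
      with (/ y * (2 * (y * y) / (y * y + m * m))) by (field; lra).
    apply Rmult_le_compat; try lra.
    apply Rle_div_r; [lra|].
    assert (q * (y * y + m * m) <= q * (2 * (INR n + 1 + INR r * m))).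
    { apply Rmult_le_compat_l; [lra|]. rewrite Hyy. unfold m. nra. }
    rewrite Hyy at 2. lra. }
  assert (H1 : 2 * y / (y * y + m * m) <= / m).
  { apply Rle_div_l; [lra|]. apply (Rmult_le_reg_l m); [lra|].
    replace (m * (/ m * (y * y + m * m))) with (y * y + m * m) by (field; lra).
    pose proof (Rle_0_sqr (y - m)) as Hsq. unfold Rsqr in Hsq. lra. }
  assert (H2 : 2 * y / (y * y + m * m) * (y / m) <= 2 * / m).
  { replace (2 * y / (y * y + m * m) * (y / m))
      with (2 * / m * (y * y / (y * y + m * m))) by (field; lra).
    assert (y * y / (y * y + m * m) <= 1) by (apply Rle_div_l; nra).
    assert (0 < / m) by (apply Rinv_0_lt_compat; lra).
    apply Rle_trans with (2 * / m * 1); [|lra].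
    apply Rmult_le_compat_l; lra. }
  split; [lra|].
  assert (Hpq : 0 <= p * q) by (apply Rmult_le_pos; lra).
  set (k := 2 * y / (y * y + m * m)) in *.
  apply Rle_trans with (k * (1 + 2 * harmonic r + 2 * (y / m))).
  - apply Rmult_le_compat; lra.
  - pose proof (harmonic_ge_0 r).
    assert (k * (1 + 2 * harmonic r) <= / m * (1 + 2 * harmonic r))
      by (apply Rmult_le_compat_r; lra).
    unfold Rdiv. lra.
Qed.

Lemma harmonic_sum_step_bound (N r : nat) :
  Rabs (weighted_sum shifted_harmonic N (S r) - weighted_sum shifted_harmonic N r)
  <= 40 * ((1 + harmonic r) / (INR r + 1)).
Proof.
  rewrite harmonic_sum_step.
  pose proof (certificate_bounds (S N) r) as HG.
  pose proof (central_falling_ratio_bound (S N) r) as [H1 H2].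
  pose proof (plain_sum_bounds N (S r)) as Hg.
  pose proof (harmonic_ge_0 (S N)) as Hh. pose proof (harmonic_ge_0 r) as Hh'.
  pose proof (pos_INR r) as Hr.
  assert (Hi : 0 < / (INR r + 1) <= 1).
  { split; [apply Rinv_0_lt_compat; lra|].
    rewrite <- Rinv_1. apply Rinv_le_contravar; lra. }
  assert (Hln : 0 <= ln 4 <= 3).
  { split; [rewrite <- ln_1; apply ln_le; lra|].
    pose proof (ln_le_pred 4 ltac:(lra)). lra. }
  set (pq := central (S N) * falling_ratio (S N) r) in *.
  set (i := / (INR r + 1)) in *. set (h := harmonic (S N)) in *.
  assert (Hw : Rabs (shifted_harmonic (S N) - i) <= h + 4).
  { unfold shifted_harmonic. fold h. apply Rabs_le. lra. }
  assert (HGw : Rabs (certificate (S N) r * (shifted_harmonic (S N) - i))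
                <= 4 * (pq * (h + 4))).
  { rewrite Rabs_mult. rewrite <- Rmult_assoc.
    apply Rmult_le_compat; try apply Rabs_pos; [|exact Hw].
    apply Rabs_le. lra. }
  assert (Hg' : Rabs (2 / (INR r + 1) * weighted_sum plain N (S r)) <= 4 * i).
  { unfold Rdiv. fold i. set (g := weighted_sum plain N (S r)) in *.
    assert (0 <= i * g <= i * 2).
    { split; [apply Rmult_le_pos|apply Rmult_le_compat_l]; lra. }
    apply Rabs_le. lra. }
  assert (0 <= harmonic r * i) by (apply Rmult_le_pos; lra).
  (* In units of 1/(r+1), the certificate contributes 20 + 8 H_r through H_(N+1)
     and 16 through the constant part of the weight; the plain sum contributes 4. *)
  eapply Rle_trans; [apply Rabs_triang|].
  unfold Rdiv in *. fold i in H2, Hg' |- *. lra.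
Qed.

(** The certificate is at most 4 p_n in absolute value, so boundary terms vanish
    in the limit. *)
Lemma lim_certificate (w : nat -> R) (r : nat) :
  is_lim_seq (fun N => central N * w N) 0 ->
  is_lim_seq (fun N => certificate N r * w N) 0.
Proof.
  intros H. apply is_lim_seq_abs_0. apply is_lim_seq_abs_0 in H.
  apply is_lim_seq_le_le with (fun _ => 0) (fun N => 4 * Rabs (central N * w N)).
  - intros N. split; [apply Rabs_pos|]. rewrite !Rabs_mult.
    rewrite <- Rmult_assoc. apply Rmult_le_compat_r; [apply Rabs_pos|].
    pose proof (certificate_bounds N r) as HG.
    pose proof (half_ratio_ge_0 1 N ltac:(lia)) as Hp.
    pose proof (falling_ratio_le_1 N r) as Hq.
    rewrite (Rabs_pos_eq (central N)) by exact Hp.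
    apply Rabs_le. nra.
  - apply is_lim_seq_const.
  - replace (Finite 0) with (Finite (4 * 0)) by (f_equal; ring).
    now apply (is_lim_seq_scal_l _ 4 0).
Qed.

Lemma lim_plain_sum (r : nat) : is_lim_seq (fun N => weighted_sum plain N r) 2.
Proof.
  induction r as [|r IH].
  - apply is_lim_seq_ext with (fun N => 2 - 2 * central (S N)).
    { intros N. symmetry. apply plain_sum_0. }
    replace (Finite 2) with (Finite (2 - 2 * 0)) by (f_equal; ring).
    apply is_lim_seq_minus'; [apply is_lim_seq_const|].
    apply (is_lim_seq_scal_l _ 2 0).
    apply (is_lim_seq_incr_1 (fun n => central n)), lim_central.
  - apply is_lim_seq_ext with
      (fun N => weighted_sum plain N r + certificate (S N) r * 1).
    { intros N. rewrite <- plain_sum_step. ring. }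
    replace (Finite 2) with (Finite (2 + 0)) by (f_equal; ring).
    apply is_lim_seq_plus'; [exact IH|].
    apply (is_lim_seq_incr_1 (fun N => certificate N r * 1)).
    apply lim_certificate with (w := fun _ => 1).
    apply is_lim_seq_ext with (fun n => central n); [intros; ring|].
    apply lim_central.
Qed.

Lemma lim_harmonic_sum (r : nat) :
  is_lim_seq (fun N => weighted_sum shifted_harmonic N r) (4 * harmonic r).
Proof.
  induction r as [|r IH].
  - rewrite harmonic_0. apply is_lim_seq_incr_1.
    apply is_lim_seq_ext with (fun N => 2 * sum_over_index 1 N
      - 2 * (central (S (S N)) * harmonic (S N))
      - ln 4 * weighted_sum plain (S N) 0).
    { intros N. symmetry. apply harmonic_sum_0. }
    replace (Finite (4 * 0)) with (Finite (2 * ln 4 - 2 * 0 - ln 4 * 2))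
      by (f_equal; ring).
    apply is_lim_seq_minus'; [apply is_lim_seq_minus'|].
    + apply (is_lim_seq_scal_l _ 2 (ln 4)), lim_sum_over_index.
    + apply (is_lim_seq_scal_l _ 2 0).
      apply (is_lim_seq_incr_1 (fun N => central (S N) * harmonic N)).
      apply is_lim_seq_le_le with (fun _ => 0) (fun N => central N * harmonic N).
      * intros N. pose proof (half_ratio_ge_0 1 (S N) ltac:(lia)).
        pose proof (harmonic_ge_0 N). split; [now apply Rmult_le_pos|].
        apply Rmult_le_compat_r; [assumption|].
        pose proof (kernel_ge_0 N 0) as Hk. rewrite kernel_0_r in Hk. lra.
      * apply is_lim_seq_const.
      * apply lim_central_harmonic.
    + apply (is_lim_seq_scal_l _ (ln 4) 2).
      apply (is_lim_seq_incr_1 (fun N => weighted_sum plain N 0)), lim_plain_sum.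
  - apply is_lim_seq_ext with (fun N => weighted_sum shifted_harmonic N r
      + certificate (S N) r * (shifted_harmonic (S N) - / (INR r + 1))
      + 2 / (INR r + 1) * weighted_sum plain N (S r)).
    { intros N. pose proof (harmonic_sum_step N r). lra. }
    rewrite harmonic_S.
    replace (Finite (4 * (harmonic r + / (INR r + 1))))
      with (Finite (4 * harmonic r + 0 + 2 / (INR r + 1) * 2))
      by (f_equal; unfold Rdiv; ring).
    apply is_lim_seq_plus'; [apply is_lim_seq_plus'; [exact IH|]|].
    + apply (is_lim_seq_incr_1
        (fun N => certificate N r * (shifted_harmonic N - / (INR r + 1)))).
      apply lim_certificate with (w := fun N => shifted_harmonic N - / (INR r + 1)).
      apply is_lim_seq_ext with
        (fun N => central N * harmonic N - (ln 4 + / (INR r + 1)) * central N).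
      { intros N. unfold shifted_harmonic. ring. }
      replace (Finite 0) with (Finite (0 - (ln 4 + / (INR r + 1)) * 0))
        by (f_equal; ring).
      apply is_lim_seq_minus'; [apply lim_central_harmonic|].
      apply (is_lim_seq_scal_l _ _ 0), lim_central.
    + apply (is_lim_seq_scal_l _ _ 2), lim_plain_sum.
Qed.

Lemma plain_sum_step_bound (N r : nat) :
  Rabs (weighted_sum plain N (S r) - weighted_sum plain N r)
  <= 40 * ((1 + harmonic r) / (INR r + 1)).
Proof.
  rewrite plain_sum_step.
  pose proof (certificate_bounds (S N) r) as HG.
  pose proof (proj1 (central_falling_ratio_bound (S N) r)) as H1.
  pose proof (harmonic_ge_0 r). pose proof (pos_INR r).
  assert (Hi : 0 < / (INR r + 1)) by (apply Rinv_0_lt_compat; lra).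
  assert (0 <= harmonic r * / (INR r + 1)) by (apply Rmult_le_pos; lra).
  unfold Rdiv. apply Rabs_le. lra.
Qed.

(** * Convergence of complex sequences *)

Lemma sum_SnC (f : nat -> C) (n : nat) :
  sum_n f (S n) = (sum_n f n + f (S n))%C :> C.
Proof. exact (sum_Sn f n). Qed.

(** Convergence in modulus, so that complex limits reduce to real ones. *)
Definition Cconv (u : nat -> C) (l : C) : Prop :=
  is_lim_seq (fun n => Cmod (u n - l)%C) 0.

Lemma Cconv_squeeze (u : nat -> C) (l : C) (e : nat -> R) :
  (forall n, Cmod (u n - l)%C <= e n) -> is_lim_seq e 0 -> Cconv u l.
Proof.
  intros H He. apply is_lim_seq_le_le with (fun _ => 0) e;
    [|apply is_lim_seq_const|exact He].
  intros n. split; [apply Cmod_ge_0|apply H].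
Qed.

Lemma Cconv_ext (u v : nat -> C) (l : C) :
  (forall n, u n = v n) -> Cconv u l -> Cconv v l.
Proof.
  intros H. apply is_lim_seq_ext. intros n. now rewrite H.
Qed.

Lemma Cconv_const (l : C) : Cconv (fun _ => l) l.
Proof.
  apply Cconv_squeeze with (fun _ => 0); [|apply is_lim_seq_const].
  intros _. replace (l - l)%C with (RtoC 0) by ring. rewrite Cmod_0. lra.
Qed.

Lemma Cconv_plus (u v : nat -> C) (l k : C) :
  Cconv u l -> Cconv v k -> Cconv (fun n => u n + v n)%C (l + k)%C.
Proof.
  intros Hu Hv.
  apply Cconv_squeeze with (fun n => Cmod (u n - l)%C + Cmod (v n - k)%C).
  - intros n. replace (u n + v n - (l + k))%C with ((u n - l) + (v n - k))%C by ring.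
    apply Cmod_triangle.
  - replace (Finite 0) with (Finite (0 + 0)) by (f_equal; ring).
    now apply is_lim_seq_plus'.
Qed.

Lemma Cconv_scal (c : C) (u : nat -> C) (l : C) :
  Cconv u l -> Cconv (fun n => c * u n)%C (c * l)%C.
Proof.
  intros Hu. apply Cconv_squeeze with (fun n => Cmod c * Cmod (u n - l)%C).
  - intros n. replace (c * u n - c * l)%C with (c * (u n - l))%C by ring.
    rewrite Cmod_mult. lra.
  - replace (Finite 0) with (Finite (Cmod c * 0)) by (f_equal; ring).
    now apply (is_lim_seq_scal_l _ (Cmod c) 0).
Qed.

Lemma Cconv_RtoC (u : nat -> R) (l : R) :
  is_lim_seq u l -> Cconv (fun n => RtoC (u n)) (RtoC l).
Proof.
  intros H. apply is_lim_seq_ext with (fun n => Rabs (u n - l)).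
  - intros n. now rewrite <- RtoC_minus, Cmod_R.
  - apply is_lim_seq_abs_0 with (u := fun n => u n - l).
    replace (Finite 0) with (Finite (l - l)) by (f_equal; ring).
    apply is_lim_seq_minus'; [exact H|apply is_lim_seq_const].
Qed.

Lemma Cconv_sum (x : nat -> nat -> C) (y : nat -> C) (R : nat) :
  (forall r, Cconv (fun N => x N r) (y r)) ->
  Cconv (fun N => sum_n (x N) R) (sum_n y R).
Proof.
  intros H. induction R as [|R IH].
  - rewrite sum_O. apply Cconv_ext with (fun N => x N O); [|apply H].
    intros N. now rewrite sum_O.
  - rewrite sum_SnC. apply Cconv_ext with (fun N => sum_n (x N) R + x N (S R))%C.
    + intros N. now rewrite sum_SnC.
    + now apply Cconv_plus.
Qed.

Lemma Re_sum_n (u : nat -> C) (n : nat) :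
  Re (sum_n u n) = sum_n (fun k => Re (u k)) n.
Proof.
  induction n as [|n IH]; [now rewrite !sum_O|].
  now rewrite sum_SnC, sum_SnR, <- IH.
Qed.

Lemma Im_sum_n (u : nat -> C) (n : nat) :
  Im (sum_n u n) = sum_n (fun k => Im (u k)) n.
Proof.
  induction n as [|n IH]; [now rewrite !sum_O|].
  now rewrite sum_SnC, sum_SnR, <- IH.
Qed.

Lemma Cconv_Re_Im (u : nat -> C) (l : C) :
  Cconv u l <->
  is_lim_seq (fun n => Re (u n)) (Re l) /\ is_lim_seq (fun n => Im (u n)) (Im l).
Proof.
  assert (Hlim : forall (f : nat -> R) (y : R),
    is_lim_seq f y <-> is_lim_seq (fun n => Rabs (f n - y)) 0).
  { intros f y. split; intros H.
    - apply is_lim_seq_abs_0 with (u := fun n => f n - y).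
      replace (Finite 0) with (Finite (y - y)) by (f_equal; ring).
      apply is_lim_seq_minus'; [exact H|apply is_lim_seq_const].
    - apply is_lim_seq_abs_0 in H.
      apply is_lim_seq_ext with (fun n => (f n - y) + y); [intros; ring|].
      replace (Finite y) with (Finite (0 + y)) by (f_equal; ring).
      apply is_lim_seq_plus'; [exact H|apply is_lim_seq_const]. }
  rewrite (Hlim (fun n => Re (u n))), (Hlim (fun n => Im (u n))). split.
  - intros H. split;
      apply is_lim_seq_le_le with (fun _ => 0) (fun n => Cmod (u n - l)%C);
      try apply is_lim_seq_const; try exact H; intros n; split;
      try apply Rabs_pos; eapply Rle_trans; try apply (Rmax_Cmod (u n - l)%C).
    + apply Rmax_l.
    + apply Rmax_r.
  - intros [H1 H2]. apply Cconv_squeeze with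
      (fun n => sqrt 2 * (Rabs (Re (u n) - Re l) + Rabs (Im (u n) - Im l))).
    + intros n. eapply Rle_trans; [apply Cmod_2Rmax|].
      apply Rmult_le_compat_l; [apply sqrt_pos|].
      change (fst (u n - l)%C) with (Re (u n) - Re l).
      change (snd (u n - l)%C) with (Im (u n) - Im l).
      pose proof (Rabs_pos (Re (u n) - Re l)). pose proof (Rabs_pos (Im (u n) - Im l)).
      apply Rmax_lub; lra.
    + replace (Finite 0) with (Finite (sqrt 2 * (0 + 0))) by (f_equal; ring).
      apply (is_lim_seq_scal_l _ (sqrt 2) (0 + 0)).
      now apply is_lim_seq_plus'.
Qed.

Lemma Cconv_series (u : nat -> C) (l : C) :
  Cconv (sum_n u) l -> ex_Cseries u /\ CSeries u = l.
Proof.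
  intros H. apply Cconv_Re_Im in H as [HRe HIm]. split.
  - exists l. apply filterlim_locally. intros eps.
    apply is_lim_seq_spec in HRe. apply is_lim_seq_spec in HIm.
    destruct (HRe eps) as [N1 H1]. destruct (HIm eps) as [N2 H2].
    exists (max N1 N2). intros n Hn. split.
    + apply (H1 n). lia.
    + apply (H2 n). lia.
  - unfold CSeries. rewrite (surjective_pairing l). f_equal.
    + apply is_series_unique.
      apply (is_lim_seq_ext (fun n => Re (sum_n u n)) _ (Re l)); [|exact HRe].
      intros n. apply Re_sum_n.
    + apply is_series_unique.
      apply (is_lim_seq_ext (fun n => Im (sum_n u n)) _ (Im l)); [|exact HIm].
      intros n. apply Im_sum_n.
Qed.

Lemma Cconv_sum_shift (u : nat -> C) (l : C) :
  u O = RtoC 0 -> Cconv (sum_n u) l -> Cconv (sum_n (fun n => u (S n))) l.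
Proof.
  intros H0 H. apply Cconv_ext with (fun n => sum_n u (S n)).
  - intros n. induction n as [|n IH].
    + rewrite sum_SnC, !sum_O, H0. apply Cplus_0_l.
    + rewrite sum_SnC, IH. now rewrite (sum_SnC (fun n => u (S n))).
  - now apply (is_lim_seq_incr_1 (fun n => Cmod (sum_n u n - l)%C)).
Qed.

Lemma telescoping_sum_le (c : nat -> C) (m : nat -> R) (n k : nat) :
  (forall r, Cmod (c r) <= m r - m (S r)) ->
  Cmod (sum_n c (n + k) - sum_n c n)%C <= m (S n) - m (S (n + k)).
Proof.
  intros H. induction k as [|k IH].
  - rewrite Nat.add_0_r. replace (sum_n c n - sum_n c n)%C with (RtoC 0) by ring.
    rewrite Cmod_0. lra.
  - rewrite Nat.add_succ_r, sum_SnC.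
    replace (sum_n c (n + k) + c (S (n + k)) - sum_n c n)%C
      with ((sum_n c (n + k) - sum_n c n) + c (S (n + k)))%C by ring.
    eapply Rle_trans; [apply Cmod_triangle|]. specialize (H (S (n + k))). lra.
Qed.

Lemma majorant_ge_0 (c : nat -> C) (m : nat -> R) (n : nat) :
  (forall r, Cmod (c r) <= m r - m (S r)) -> is_lim_seq m 0 -> 0 <= m n.
Proof.
  intros H Hm.
  assert (Hdec : forall k, m (S k) <= m k).
  { intros k. specialize (H k). pose proof (Cmod_ge_0 (c k)). lra. }
  exact (is_lim_seq_decr_compare m 0 Hm Hdec n).
Qed.

(** A series whose terms are dominated by the decrements of a sequence tending to
    0 converges, and that sequence also dominates its tails [V].  Dominating by
    decrements m_r - m_(r+1) gives the tail bound without summing anything. *)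
Lemma exists_tails (c : nat -> C) (m : nat -> R) :
  (forall r, Cmod (c r) <= m r - m (S r)) -> is_lim_seq m 0 ->
  exists V : nat -> C,
    (forall r, V r - V (S r) = c r)%C /\ (forall r, Cmod (V r) <= m r)
    /\ Cconv (sum_n c) (V O).
Proof.
  intros H Hm.
  assert (Hser : ex_series (fun r => m r - m (S r))).
  { assert (E : forall n, sum_n (fun r => m r - m (S r)) n = m O - m (S n) :> R).
    { intros n. induction n as [|n IH]; [now rewrite sum_O|].
      rewrite sum_SnR, IH. ring. }
    exists (m O). apply (is_lim_seq_ext (fun n => m O - m (S n)) _ (m O)).
    - intros n. symmetry. apply E.
    - replace (Finite (m O)) with (Finite (m O - 0)) by (f_equal; ring).
      apply is_lim_seq_minus'; [apply is_lim_seq_const|].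
      now apply (is_lim_seq_incr_1 m). }
  assert (HRe : ex_series (fun r => Re (c r))).
  { apply (ex_series_le (fun r => Re (c r)) _) with (2 := Hser). intros r.
    eapply Rle_trans; [|apply H].
    eapply Rle_trans; [|apply Rmax_Cmod]. apply Rmax_l. }
  assert (HIm : ex_series (fun r => Im (c r))).
  { apply (ex_series_le (fun r => Im (c r)) _) with (2 := Hser). intros r.
    eapply Rle_trans; [|apply H].
    eapply Rle_trans; [|apply Rmax_Cmod]. apply Rmax_r. }
  destruct HRe as [l1 H1]. destruct HIm as [l2 H2].
  assert (HL : Cconv (sum_n c) (l1, l2)).
  { apply Cconv_Re_Im. split.
    - apply (is_lim_seq_ext (sum_n (fun r => Re (c r))) _ l1); [|exact H1].
      intros n. symmetry. apply Re_sum_n.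
    - apply (is_lim_seq_ext (sum_n (fun r => Im (c r))) _ l2); [|exact H2].
      intros n. symmetry. apply Im_sum_n. }
  set (L := (l1, l2) : C) in *.
  (* V_r is L minus the sum of the c_k over k < r; the recursion avoids an empty
     sum at r = 0. *)
  exists (nat_rect (fun _ => C) L (fun r v => v - c r)%C).
  set (V := nat_rect (fun _ => C) L (fun r v => v - c r)%C).
  assert (HV : forall r, V (S r) = (L - sum_n c r)%C).
  { intros r. induction r as [|r IH]; [now rewrite sum_O|].
    change (V (S (S r))) with (V (S r) - c (S r))%C.
    rewrite IH, sum_SnC. ring. }
  assert (Hbnd : forall r, Cmod (V (S r)) <= m (S r)).
  { intros r. rewrite HV.
    apply (is_lim_seq_le (fun _ => Cmod (L - sum_n c r)%C)
      (fun k => m (S r) + Cmod (sum_n c (k + r)%nat - L)%C)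
      (Cmod (L - sum_n c r)%C) (m (S r))).
    - intros k. rewrite (Nat.add_comm k).
      pose proof (telescoping_sum_le c m r k H) as H3.
      pose proof (majorant_ge_0 c m (S (r + k)) H Hm).
      replace (L - sum_n c r)%C
        with ((sum_n c (r + k) - sum_n c r) + - (sum_n c (r + k) - L))%C by ring.
      eapply Rle_trans; [apply Cmod_triangle|]. rewrite Cmod_opp. lra.
    - apply is_lim_seq_const.
    - replace (Finite (m (S r))) with (Finite (m (S r) + 0)) by (f_equal; ring).
      apply is_lim_seq_plus'; [apply is_lim_seq_const|].
      now apply (is_lim_seq_incr_n (fun k => Cmod (sum_n c k - L)%C)). }
  repeat split.
  - intros r. change (V (S r)) with (V r - c r)%C. ring.
  - intros [|r]; [|apply Hbnd].
    replace (V O) with (V 1%nat + c O)%C.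
    + eapply Rle_trans; [apply Cmod_triangle|].
      specialize (H O). specialize (Hbnd O). lra.
    + change (V 1%nat) with (V O - c O)%C. ring.
  - exact HL.
Qed.

(** Tannery's theorem, for a triangular array with a majorant given by
    decrements. *)
Lemma tannery (x : nat -> nat -> C) (y : nat -> C) (m : nat -> R) (L : C) :
  (forall N r, Cmod (x N r) <= m r - m (S r)) -> is_lim_seq m 0 ->
  (forall r, Cconv (fun N => x N r) (y r)) ->
  Cconv (sum_n y) L -> Cconv (fun N => sum_n (x N) N) L.
Proof.
  intros Hx Hm Hy HL. apply is_lim_seq_spec. intros eps.
  assert (He : 0 < eps / 3) by (pose proof (cond_pos eps); lra).
  set (e := mkposreal _ He).
  pose proof Hm as Hm0. apply is_lim_seq_spec in Hm0.
  apply is_lim_seq_spec in HL.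
  destruct (Hm0 e) as [N1 H1]. destruct (HL e) as [N2 H2].
  set (R := max N1 N2).
  specialize (H1 (S R) ltac:(lia)). specialize (H2 R ltac:(lia)).
  pose proof (Cconv_sum x y R Hy) as HR. apply is_lim_seq_spec in HR.
  destruct (HR e) as [N3 H3].
  exists (max R N3). intros N HN. specialize (H3 N ltac:(lia)).
  rewrite Rminus_0_r in *. rewrite Rabs_pos_eq in H2, H3 |- * by apply Cmod_ge_0.
  simpl in H1, H2, H3.
  pose proof (telescoping_sum_le (x N) m R (N - R) (Hx N)) as H4.
  replace (R + (N - R))%nat with N in H4 by lia.
  pose proof (majorant_ge_0 (x N) m (S N) (Hx N) Hm).
  apply Rabs_def2 in H1.
  replace (sum_n (x N) N - L)%C with
    ((sum_n (x N) N - sum_n (x N) R)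
     + ((sum_n (x N) R - sum_n y R) + (sum_n y R - L)))%C by ring.
  eapply Rle_lt_trans; [apply Cmod_triangle|].
  eapply Rle_lt_trans; [apply Rplus_le_compat_l, Cmod_triangle|]. lra.
Qed.

(** * Passing to the limit through the kernel *)

(** Summation by parts, with beta given as the decrements of T. *)
Lemma sum_by_parts (T beta : nat -> C) (g : nat -> R) (n : nat) :
  (forall r, T r - T (S r) = beta r)%C ->
  sum_n (fun r => beta r * RtoC (g r))%C n
  = (T O * RtoC (g O) + sum_n (fun r => T (S r) * RtoC (g (S r) - g r))%C n
     - T (S n) * RtoC (g (S n)))%C :> C.
Proof.
  intros H. induction n as [|n IH].
  - rewrite !sum_O, <- H, RtoC_minus. ring.
  - rewrite !sum_SnC, IH, <- H, RtoC_minus. ring.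
Qed.

(** The Bailey transform of beta with respect to [kernel]. *)
Definition kernel_transform (beta : nat -> C) (n : nat) : C :=
  sum_n (fun r => beta r * RtoC (kernel n r))%C n.

Lemma sum_kernel_transform (beta : nat -> C) (w : nat -> R) (N : nat) :
  sum_n (fun n => kernel_transform beta n * RtoC (w n))%C N
  = sum_n (fun r => beta r * RtoC (weighted_sum w N r))%C N :> C.
Proof.
  induction N as [|N IH].
  - unfold kernel_transform, weighted_sum. rewrite !sum_O, RtoC_mult. ring.
  - rewrite sum_SnC, IH, (sum_SnC _ N).
    rewrite weighted_sum_S, weighted_sum_gt by lia.
    unfold kernel_transform. rewrite (sum_SnC _ N), Rplus_0_l, RtoC_mult.
    assert (E : sum_n (fun r => beta r * RtoC (weighted_sum w (S N) r))%C N
      = (sum_n (fun r => beta r * RtoC (weighted_sum w N r))%C N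
        + sum_n (fun r => beta r * RtoC (kernel (S N) r))%C N * RtoC (w (S N)))%C :> C).
    { (* Frees the summation bound from the truncation of the columns. *)
      generalize N at 2 4 6. intros M. induction M as [|M IHM].
      - rewrite !sum_O, weighted_sum_S, RtoC_plus, RtoC_mult. ring.
      - rewrite !sum_SnC, IHM, weighted_sum_S, RtoC_plus, RtoC_mult. ring. }
    rewrite E. ring.
Qed.

(** The exchange of summations.  After summation by parts only the increments of
    the column sums appear, and it is their product with the tails T that has to
    be dominated: beta itself need not be absolutely summable. *)
Lemma lim_sum_kernel_transform (T beta : nat -> C) (w f m : nat -> R) (L : C) :
  (forall r, T r - T (S r) = beta r)%C ->
  (forall N r, Cmod (T (S r)) * Rabs (weighted_sum w N (S r) - weighted_sum w N r)
               <= m r - m (S r)) ->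
  is_lim_seq m 0 ->
  (forall r, is_lim_seq (fun N => weighted_sum w N r) (f r)) ->
  Cconv (sum_n (fun r => T (S r) * RtoC (f (S r) - f r))%C) L ->
  Cconv (sum_n (fun n => kernel_transform beta n * RtoC (w n))%C)
    (T O * RtoC (f O) + L)%C.
Proof.
  intros HT Hm Hm0 Hf HL.
  set (x := fun N r =>
    (T (S r) * RtoC (weighted_sum w N (S r) - weighted_sum w N r))%C).
  apply Cconv_ext with
    (fun N => T O * RtoC (weighted_sum w N O) + sum_n (x N) N)%C.
  - intros N. rewrite sum_kernel_transform, (sum_by_parts T beta _ N HT).
    rewrite (weighted_sum_gt w N (S N)) by lia. fold (x N).
    change (fun r =>
      (T (S r) * RtoC (weighted_sum w N (S r) - weighted_sum w N r))%C) with (x N).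
    ring.
  - apply Cconv_plus.
    + apply Cconv_scal, Cconv_RtoC, Hf.
    + apply tannery with (3 := fun r => Cconv_scal (T (S r)) _ _
        (Cconv_RtoC _ _ (is_lim_seq_minus' _ _ _ _ (Hf (S r)) (Hf r))))
        (m := m); [|exact Hm0|exact HL].
      intros N r. unfold x. rewrite Cmod_mult, Cmod_R. apply Hm.
Qed.

(** * The terminating well-poised sum *)

(** Well-poised: each upper parameter and its lower partner add up to 2. *)
Definition alternating_coeff (a b : C) (n : nat) : C :=
  (pochhammer (1 - a) n * pochhammer (1 - b) n
   / (pochhammer (1 + a) n * pochhammer (1 + b) n)
   * Cpow (RtoC (-1)) n)%C.

(** The common coefficient of the 3F2 series and of the harmonic series on the
    left-hand side. *)
Definition hyp_coeff (a b : C) (n : nat) : C :=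
  (pochhammer (RtoC (1 / 2)) n * pochhammer (a + b) n
   / (pochhammer (1 + a) n * pochhammer (1 + b) n))%C.

Definition not_negative_integer (a : C) : Prop :=
  forall k : nat, a <> RtoC (- INR (S k)).

Lemma shift_neq_0 (a : C) (n : nat) :
  not_negative_integer a -> (1 + a + RtoC (INR n))%C <> 0.
Proof.
  intros Ha E. apply (Ha n). rewrite S_INR, RtoC_opp, RtoC_plus.
  replace a with ((1 + a + RtoC (INR n)) - (RtoC (INR n) + 1))%C by ring.
  rewrite E. ring.
Qed.

Lemma pochhammer_neq_0 (a : C) (n : nat) :
  not_negative_integer a -> pochhammer (1 + a) n <> 0.
Proof.
  intros Ha. induction n as [|n IH]; simpl.
  - intros E. apply RtoC_inj in E. lra.
  - apply Cmult_neq_0; [exact IH|now apply shift_neq_0].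
Qed.

Lemma RtoC_neq_0 (x : R) : x <> 0 -> RtoC x <> 0.
Proof. intros H E. now apply H, RtoC_inj. Qed.

Lemma alternating_S (a b : C) (n : nat) :
  not_negative_integer a -> not_negative_integer b ->
  alternating_coeff a b (S n)
  = (- alternating_coeff a b n * ((1 - a + RtoC (INR n)) * (1 - b + RtoC (INR n)))
     / ((1 + a + RtoC (INR n)) * (1 + b + RtoC (INR n))))%C.
Proof.
  intros Ha Hb. unfold alternating_coeff. rewrite Cpow_S. simpl pochhammer.
  replace (RtoC (-1)) with (- RtoC 1)%C by (rewrite <- RtoC_opp; reflexivity).
  field. repeat split; try now apply shift_neq_0.
  all: now apply pochhammer_neq_0.
Qed.

Lemma hyp_coeff_S (a b : C) (n : nat) :
  not_negative_integer a -> not_negative_integer b ->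
  hyp_coeff a b (S n)
  = (hyp_coeff a b n * ((RtoC (1 / 2) + RtoC (INR n)) * (a + b + RtoC (INR n)))
     / ((1 + a + RtoC (INR n)) * (1 + b + RtoC (INR n))))%C.
Proof.
  intros Ha Hb. unfold hyp_coeff. simpl pochhammer.
  field. repeat split; try now apply shift_neq_0.
  all: now apply pochhammer_neq_0.
Qed.

(** The r-th term of the terminating well-poised 5F4 with upper parameters 1, 3/2,
    1-a, 1-b, -n and argument 1. *)
Definition dougall_term (a b : C) (n r : nat) : C :=
  (RtoC (2 * INR r + 1) * alternating_coeff a b r * RtoC (falling_ratio n r))%C.

(** Antidifference in r that witnesses the first-order recurrence in n of the
    terminating 5F4, in the style of Wilf and Zeilberger. *)
Definition dougall_certificate (a b : C) (n r : nat) : C :=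
  (- (RtoC (INR r) * (a + RtoC (INR r)) * (b + RtoC (INR r)) * alternating_coeff a b r
     * RtoC ((INR n + INR r + 2) / (INR n + 1) * falling_ratio (S n) r)))%C.

Lemma dougall_step (a b : C) (n r : nat) :
  not_negative_integer a -> not_negative_integer b ->
  ((1 + a + RtoC (INR n)) * (1 + b + RtoC (INR n)) * dougall_term a b (S n) r
   - (RtoC (INR n) + 2) * (a + b + RtoC (INR n)) * dougall_term a b n r
   = dougall_certificate a b n (S r) - dougall_certificate a b n r)%C.
Proof.
  intros Ha Hb. unfold dougall_term, dougall_certificate.
  pose proof (pos_INR n) as Hn. pose proof (pos_INR r) as Hr.
  assert (E : falling_ratio n r = falling_ratio (S n) r *
    ((INR n + 1 - INR r) * (INR n + INR r + 2)) / ((INR n + 1) * (INR n + 2))).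
  { rewrite <- falling_ratio_succ_l. field. lra. }
  rewrite E, alternating_S, falling_ratio_S, !S_INR by assumption.
  replace ((INR n + (INR r + 1) + 2) / (INR n + 1) *
    (falling_ratio (S n) r * (INR n + 1 - INR r) / (INR n + 1 + INR r + 2)))
    with (falling_ratio (S n) r * (INR n + 1 - INR r) / (INR n + 1))
    by (field; lra).
  set (q := falling_ratio (S n) r).
  assert (Hn1 : RtoC (INR n + 1) <> 0) by (apply RtoC_neq_0; lra).
  assert (Hn2 : RtoC (INR n + 2) <> 0) by (apply RtoC_neq_0; lra).
  assert (Hn12 : (INR n + 1) * (INR n + 2) <> 0) by (apply Rgt_not_eq; nra).
  pose proof (shift_neq_0 a r Ha) as Ha'. pose proof (shift_neq_0 b r Hb) as Hb'.
  rewrite !RtoC_mult, !RtoC_div by lra.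
  rewrite !RtoC_mult, ?RtoC_minus, ?RtoC_plus, ?RtoC_mult in *.
  field. repeat split; assumption.
Qed.

Definition dougall_sum (a b : C) (n : nat) : C :=
  sum_n (dougall_term a b n) n.

(** Sum of [dougall_step] over r: the certificate vanishes at r = 0 because of its
    factor r, and at r = n+2 because the falling ratio does. *)
Lemma dougall_sum_S (a b : C) (n : nat) :
  not_negative_integer a -> not_negative_integer b ->
  ((1 + a + RtoC (INR n)) * (1 + b + RtoC (INR n)) * dougall_sum a b (S n)
   = (RtoC (INR n) + 2) * (a + b + RtoC (INR n)) * dougall_sum a b n)%C.
Proof.
  intros Ha Hb. unfold dougall_sum.
  set (c := ((1 + a + RtoC (INR n)) * (1 + b + RtoC (INR n)))%C).
  set (d := ((RtoC (INR n) + 2) * (a + b + RtoC (INR n)))%C).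
  assert (H : forall R, (c * sum_n (dougall_term a b (S n)) R
    - d * sum_n (dougall_term a b n) R
    = dougall_certificate a b n (S R) - dougall_certificate a b n O)%C).
  { intros R. induction R as [|R IH].
    - rewrite !sum_O. now apply dougall_step.
    - rewrite !sum_SnC.
      transitivity ((c * sum_n (dougall_term a b (S n)) R
          - d * sum_n (dougall_term a b n) R)
        + (c * dougall_term a b (S n) (S R) - d * dougall_term a b n (S R)))%C;
        [ring|].
      unfold c at 2, d at 2. rewrite IH, dougall_step by assumption. ring. }
  specialize (H (S n)).
  assert (E1 : dougall_certificate a b n (S (S n)) = 0).
  { unfold dougall_certificate. rewrite falling_ratio_gt, Rmult_0_r by lia. ring. }
  assert (E2 : dougall_certificate a b n O = 0).
  { unfold dougall_certificate. simpl (INR 0). ring. }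
  assert (E3 : sum_n (dougall_term a b n) (S n) = sum_n (dougall_term a b n) n :> C).
  { rewrite sum_SnC. unfold dougall_term at 2.
    rewrite falling_ratio_gt by lia. ring. }
  rewrite E1, E2, E3 in H.
  transitivity ((c * sum_n (dougall_term a b (S n)) (S n)
    - d * sum_n (dougall_term a b n) n) + d * sum_n (dougall_term a b n) n)%C;
    [ring|].
  rewrite H. ring.
Qed.

Lemma hyp_coeff_kernel_transform (a b : C) (n : nat) :
  not_negative_integer a -> not_negative_integer b ->
  hyp_coeff a b n = kernel_transform (alternating_coeff a b) n.
Proof.
  intros Ha Hb.
  assert (E : kernel_transform (alternating_coeff a b) n
    = (RtoC (central n / (INR n + 1)) * dougall_sum a b n)%C).
  { unfold kernel_transform.
    assert (H : forall R,
      sum_n (fun r => alternating_coeff a b r * RtoC (kernel n r))%C R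
      = (RtoC (central n / (INR n + 1)) * sum_n (dougall_term a b n) R)%C :> C).
    { intros R. unfold kernel, dougall_term. induction R as [|R IH].
      - rewrite !sum_O, !RtoC_mult. ring.
      - rewrite !sum_SnC, IH, !RtoC_mult. ring. }
    apply H. }
  rewrite E. clear E. induction n as [|n IH].
  - unfold hyp_coeff, dougall_sum, dougall_term, alternating_coeff.
    rewrite sum_O. simpl.
    replace (2 * 0 + 1) with 1 by ring. replace (1 / (0 + 1)) with 1 by field.
    field.
  - pose proof (pos_INR n) as Hn.
    assert (Hn1 : (RtoC (INR n) + 1)%C <> 0)
      by (rewrite <- RtoC_plus; apply RtoC_neq_0; lra).
    assert (Hn2 : (RtoC (INR n) + 2)%C <> 0)
      by (rewrite <- RtoC_plus; apply RtoC_neq_0; lra).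
    pose proof (shift_neq_0 a n Ha) as Ha'. pose proof (shift_neq_0 b n Hb) as Hb'.
    pose proof (dougall_sum_S a b n Ha Hb) as HS.
    assert (Es : dougall_sum a b (S n) = ((RtoC (INR n) + 2) * (a + b + RtoC (INR n))
      * dougall_sum a b n
      / ((1 + a + RtoC (INR n)) * (1 + b + RtoC (INR n))))%C :> C).
    { rewrite <- HS. field. split; assumption. }
    rewrite hyp_coeff_S, IH, Es by assumption.
    replace (central (S n) / (INR (S n) + 1)) with
      (central n / (INR n + 1) * ((1 / 2 + INR n) / (INR n + 2)))
      by (rewrite half_ratio_S, (S_INR n); simpl (INR 1); field; lra).
    rewrite RtoC_mult, (RtoC_div (1 / 2 + INR n)), !RtoC_plus by lra.
    field. repeat split; assumption.
Qed.

(** * Decay of the alternating summand *)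

Lemma Cmod_sqr (z : C) : Cmod z * Cmod z = Re z * Re z + Im z * Im z.
Proof.
  unfold Cmod. rewrite sqrt_sqrt.
  - unfold Re, Im. ring.
  - apply Rplus_le_le_0_compat; apply pow2_ge_0.
Qed.

(** (m / |m + a|)^2 with m = n+1, which tends to 1. *)
Definition sqr_ratio (a : C) (n : nat) : R :=
  (INR n + 1) * (INR n + 1)
  / (Cmod (1 + a + RtoC (INR n))%C * Cmod (1 + a + RtoC (INR n))%C).

Lemma lim_sqr_ratio (a : C) :
  not_negative_integer a -> is_lim_seq (sqr_ratio a) 1.
Proof.
  intros Ha.
  apply is_lim_seq_ext with (fun n =>
    / ((1 + Re a * / (INR n + 1)) * (1 + Re a * / (INR n + 1))
       + (Im a * / (INR n + 1)) * (Im a * / (INR n + 1)))).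
  - intros n. pose proof (pos_INR n). unfold sqr_ratio.
    pose proof (shift_neq_0 a n Ha) as Hz. apply Cmod_gt_0 in Hz.
    assert (Hz2 : 0 < Cmod (1 + a + RtoC (INR n))%C * Cmod (1 + a + RtoC (INR n))%C)
      by now apply Rmult_lt_0_compat.
    rewrite Cmod_sqr in Hz2 |- *.
    change (Re (1 + a + RtoC (INR n))%C) with (1 + Re a + INR n) in *.
    replace (Im (1 + a + RtoC (INR n))%C) with (Im a) in * by (simpl; unfold Im; ring).
    replace ((1 + Re a * / (INR n + 1)) * (1 + Re a * / (INR n + 1))
       + (Im a * / (INR n + 1)) * (Im a * / (INR n + 1)))
      with (((1 + Re a + INR n) * (1 + Re a + INR n) + Im a * Im a)
            / ((INR n + 1) * (INR n + 1))) by (field; lra).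
    rewrite Rinv_div. reflexivity.
  - assert (H : forall c, is_lim_seq (fun n => c * / (INR n + 1)) 0).
    { intros c. replace (Finite 0) with (Finite (c * 0)) by (f_equal; ring).
      apply (is_lim_seq_scal_l _ c 0), lim_inv_succ. }
    replace (Finite 1) with (Rbar_inv (Finite ((1 + 0) * (1 + 0) + 0 * 0)))
      by (simpl; f_equal; field).
    apply is_lim_seq_inv.
    + apply is_lim_seq_plus'; apply is_lim_seq_mult';
        try apply is_lim_seq_plus'; try apply is_lim_seq_const; apply H.
    + intros E. injection E. lra.
Qed.

(** |m - a|^2 = |m + a|^2 - 4 m Re a, and 1 - x <= exp (-x). *)
Lemma Cmod_reflect_le (a : C) (n : nat) :
  not_negative_integer a ->
  Cmod (1 - a + RtoC (INR n))%C
  <= Cmod (1 + a + RtoC (INR n))%C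
     * exp (- (2 * Re a * sqr_ratio a n / (INR n + 1))).
Proof.
  intros Ha. pose proof (pos_INR n).
  pose proof (shift_neq_0 a n Ha) as Hz. apply Cmod_gt_0 in Hz.
  apply Rsqr_incr_0_var;
    [|apply Rmult_le_pos; [apply Cmod_ge_0|apply Rlt_le, exp_pos]].
  unfold Rsqr, sqr_ratio.
  set (z := (1 + a + RtoC (INR n))%C) in *.
  assert (E : Cmod (1 - a + RtoC (INR n))%C * Cmod (1 - a + RtoC (INR n))%C
              = Cmod z * Cmod z - 4 * Re a * (INR n + 1)).
  { rewrite !Cmod_sqr. unfold z. simpl. unfold Re, Im. ring. }
  rewrite E. set (x := Cmod z) in *.
  replace (2 * Re a * ((INR n + 1) * (INR n + 1) / (x * x)) / (INR n + 1))
    with (2 * Re a * (INR n + 1) / (x * x)) by (field; lra).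
  set (u := 2 * Re a * (INR n + 1) / (x * x)).
  replace (x * exp (- u) * (x * exp (- u))) with (x * x * exp (- u + - u))
    by (rewrite exp_plus; ring).
  replace (x * x - 4 * Re a * (INR n + 1)) with (x * x * (1 + (- u + - u)))
    by (unfold u; field; lra).
  apply Rmult_le_compat_l; [nra|]. apply exp_ineq1_le.
Qed.

Lemma eventually_bounded (u : nat -> R) (N : nat) (M : R) :
  (forall n, (N <= n)%nat -> u n <= M) -> exists M', forall n, u n <= M'.
Proof.
  revert M. induction N as [|N IH]; intros M H.
  - exists M. intros n. apply H. lia.
  - apply (IH (Rmax M (u N))). intros n Hn.
    destruct (Nat.eq_dec n N) as [->|Hne]; [apply Rmax_r|].
    eapply Rle_trans; [apply H; lia|apply Rmax_l].
Qed.

(** Comparable to n^(-d), but with an exact multiplicative recurrence. *)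
Definition decay (d : R) (n : nat) : R := exp (- (d * harmonic n)).

Lemma decay_S (d : R) (n : nat) :
  decay d (S n) = decay d n * exp (- (d / (INR n + 1))).
Proof.
  unfold decay. rewrite harmonic_S, <- exp_plus. f_equal. unfold Rdiv. ring.
Qed.

Lemma decay_gt_0 (d : R) (n : nat) : 0 < decay d n.
Proof. apply exp_pos. Qed.

Lemma lim_decay (d : R) : 0 < d -> is_lim_seq (decay d) 0.
Proof.
  intros Hd.
  assert (Hh : is_lim_seq harmonic p_infty).
  { apply is_lim_seq_le_p_loc with (fun n => ln (INR n + 1)).
    - exists O. intros n _. apply harmonic_ln_bounds.
    - apply (is_lim_comp_seq ln _ p_infty p_infty).
      + apply is_lim_ln_p.
      + exists O. intros n _. discriminate.
      + apply is_lim_seq_ext with (fun n => INR (S n)).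
        * intros n. apply S_INR.
        * apply (is_lim_seq_incr_1 INR), is_lim_seq_INR. }
  apply (is_lim_comp_seq exp (fun n => - (d * harmonic n)) m_infty 0).
  - apply is_lim_exp_m.
  - exists O. intros n _. discriminate.
  - apply (is_lim_seq_opp _ p_infty).
    apply (is_lim_seq_scal_l _ d p_infty) in Hh.
    replace (Rbar_mult d p_infty) with p_infty in Hh; [exact Hh|].
    simpl. destruct (Rle_dec 0 d) as [H|H]; [|lra].
    destruct (Rle_lt_or_eq_dec 0 d H); [reflexivity|lra].
Qed.

(** The exponential form of the comparison of n^(-d-1) with the decrement of
    n^(-d). *)
Lemma decay_telescope (d : R) (n : nat) :
  0 < d ->
  decay d n / (INR n + 1) <= exp d / d * (decay d n - decay d (S n)).
Proof.
  intros Hd. rewrite decay_S. pose proof (decay_gt_0 d n) as He.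
  pose proof (pos_INR n).
  assert (Hi : 0 < / (INR n + 1) <= 1).
  { split; [apply Rinv_0_lt_compat; lra|].
    rewrite <- Rinv_1. apply Rinv_le_contravar; lra. }
  unfold Rdiv at 1 3. set (i := / (INR n + 1)) in *.
  pose proof (exp_ineq1_le (d * i)) as H1.
  pose proof (exp_pos (- (d * i))) as H2.
  assert (H3 : exp (d * i) * exp (- (d * i)) = 1)
    by (rewrite <- exp_plus, Rplus_opp_r; apply exp_0).
  assert (H4 : exp d * exp (- (d * i)) >= 1).
  { rewrite <- exp_plus. pose proof (exp_ineq1_le (d + - (d * i))). nra. }
  assert (H5 : d * i * exp (- (d * i)) <= 1 - exp (- (d * i))) by nra.
  apply (Rmult_le_reg_l d); [exact Hd|].
  replace (d * (exp d / d * (decay d n - decay d n * exp (- (d * i)))))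
    with (decay d n * (exp d * (1 - exp (- (d * i))))) by (field; lra).
  replace (d * (decay d n * i)) with (decay d n * (d * i)) by ring.
  apply Rmult_le_compat_l; [lra|].
  apply Rle_trans with (exp d * (d * i * exp (- (d * i)))).
  - replace (exp d * (d * i * exp (- (d * i))))
      with (d * i * (exp d * exp (- (d * i)))) by ring.
    rewrite <- (Rmult_1_r (d * i)) at 1. apply Rmult_le_compat_l; nra.
  - apply Rmult_le_compat_l; [apply Rlt_le, exp_pos|exact H5].
Qed.

(** A factor H_n costs no more than half of the exponent. *)
Lemma harmonic_decay (d : R) (n : nat) :
  0 < d -> (1 + harmonic n) * decay d n <= (1 + 2 / d) * decay (d / 2) n.
Proof.
  intros Hd. pose proof (harmonic_ge_0 n) as Hh.
  replace (decay d n) with (decay (d / 2) n * decay (d / 2) n)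
    by (unfold decay; rewrite <- exp_plus; f_equal; field).
  pose proof (decay_gt_0 (d / 2) n) as He.
  assert (H : (1 + harmonic n) * decay (d / 2) n <= 1 + 2 / d).
  { apply Rle_trans with ((1 + 2 / d) * (exp (d / 2 * harmonic n) * decay (d / 2) n)).
    - rewrite <- Rmult_assoc. apply Rmult_le_compat_r; [lra|].
      pose proof (exp_ineq1_le (d / 2 * harmonic n)) as H1.
      assert (H2 : 0 < 2 / d) by (apply Rdiv_lt_0_compat; lra).
      apply Rle_trans with ((1 + 2 / d) * (1 + d / 2 * harmonic n)).
      + replace ((1 + 2 / d) * (1 + d / 2 * harmonic n))
          with (1 + harmonic n + (2 / d + d / 2 * harmonic n)) by (field; lra).
        assert (0 <= d / 2 * harmonic n) by (apply Rmult_le_pos; lra). lra.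
      + apply Rmult_le_compat_l; lra.
    - unfold decay. rewrite <- exp_plus, Rplus_opp_r, exp_0. lra. }
  rewrite <- Rmult_assoc. apply Rmult_le_compat_r; lra.
Qed.

(** By [Cmod_reflect_le] the ratio of consecutive terms is at most
    exp (- 2 s_n / (n+1)) where s_n tends to d = Re (a+b), hence eventually at
    most exp (- d / (n+1)). *)
Lemma alternating_decay (a b : C) :
  not_negative_integer a -> not_negative_integer b -> 0 < Re (a + b)%C ->
  exists M, forall n, Cmod (alternating_coeff a b n) <= M * decay (Re (a + b)%C) n.
Proof.
  intros Ha Hb Hab. set (d := Re (a + b)%C) in *.
  assert (Hlim : is_lim_seq (fun n => Re a * sqr_ratio a n + Re b * sqr_ratio b n) d).
  { replace (Finite d) with (Finite (Re a * 1 + Re b * 1))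
      by (f_equal; unfold d, Re; simpl; ring).
    apply is_lim_seq_plus'.
    - apply (is_lim_seq_scal_l _ (Re a) 1). now apply lim_sqr_ratio.
    - apply (is_lim_seq_scal_l _ (Re b) 1). now apply lim_sqr_ratio. }
  apply is_lim_seq_spec in Hlim.
  destruct (Hlim (mkposreal (d / 2) ltac:(lra))) as [N HN]. simpl in HN.
  set (u := fun n => Cmod (alternating_coeff a b n) * exp (d * harmonic n)).
  assert (Hu : forall n, (N <= n)%nat -> u (S n) <= u n).
  { intros n Hn. specialize (HN n Hn). apply Rabs_def2 in HN.
    unfold u. rewrite alternating_S, harmonic_S by assumption.
    pose proof (shift_neq_0 a n Ha) as Hza. pose proof (shift_neq_0 b n Hb) as Hzb.
    rewrite Cmod_div by now apply Cmult_neq_0.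
    rewrite !Cmod_mult, Cmod_opp.
    apply Cmod_gt_0 in Hza. apply Cmod_gt_0 in Hzb.
    pose proof (Cmod_reflect_le a n Ha) as H1.
    pose proof (Cmod_reflect_le b n Hb) as H2.
    pose proof (pos_INR n) as Hn0.
    assert (Hi : 0 < / (INR n + 1)) by (apply Rinv_0_lt_compat; lra).
    set (xa := Cmod (1 + a + RtoC (INR n))%C) in *.
    set (xb := Cmod (1 + b + RtoC (INR n))%C) in *.
    set (sa := sqr_ratio a n) in *. set (sb := sqr_ratio b n) in *.
    pose proof (Cmod_ge_0 (1 - a + RtoC (INR n))%C) as P1.
    pose proof (Cmod_ge_0 (1 - b + RtoC (INR n))%C) as P2.
    set (ya := Cmod (1 - a + RtoC (INR n))%C) in *.
    set (yb := Cmod (1 - b + RtoC (INR n))%C) in *.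
    pose proof (Cmod_ge_0 (alternating_coeff a b n)) as Hw.
    rewrite Rmult_plus_distr_l, exp_plus.
    assert (H : ya * yb <= xa * xb * exp (- (d * / (INR n + 1)))).
    { apply Rle_trans with ((xa * exp (- (2 * Re a * sa / (INR n + 1))))
                            * (xb * exp (- (2 * Re b * sb / (INR n + 1))))).
      - now apply Rmult_le_compat.
      - replace ((xa * exp (- (2 * Re a * sa / (INR n + 1))))
                  * (xb * exp (- (2 * Re b * sb / (INR n + 1)))))
          with (xa * xb * exp (- (2 * (Re a * sa + Re b * sb) * / (INR n + 1))))
          by (replace (- (2 * (Re a * sa + Re b * sb) * / (INR n + 1)))
                with (- (2 * Re a * sa / (INR n + 1)) + - (2 * Re b * sb / (INR n + 1)))
                by (unfold Rdiv; ring); rewrite exp_plus; ring).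
        apply Rmult_le_compat_l; [apply Rlt_le, Rmult_lt_0_compat; assumption|].
        apply Rnot_lt_le. intros F. apply exp_lt_inv in F. nra. }
    set (e := exp (d * / (INR n + 1))).
    assert (He : exp (- (d * / (INR n + 1))) * e = 1)
      by (unfold e; rewrite <- exp_plus, Rplus_opp_l; apply exp_0).
    assert (He0 : 0 < e) by apply exp_pos.
    assert (Hxx : 0 < xa * xb) by now apply Rmult_lt_0_compat.
    replace (Cmod (alternating_coeff a b n) * (ya * yb) / (xa * xb)
             * (exp (d * harmonic n) * e))
      with (Cmod (alternating_coeff a b n) * exp (d * harmonic n)
            * ((ya * yb) * e / (xa * xb)))
      by (field; lra).
    rewrite <- (Rmult_1_r (Cmod (alternating_coeff a b n) * exp (d * harmonic n))) at 2.
    apply Rmult_le_compat_l.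
    { apply Rmult_le_pos; [exact Hw|apply Rlt_le, exp_pos]. }
    apply Rle_div_l; [exact Hxx|].
    apply Rle_trans with (xa * xb * exp (- (d * / (INR n + 1))) * e).
    - apply Rmult_le_compat_r; lra.
    - rewrite Rmult_assoc, He. lra. }
  destruct (eventually_bounded u N (u N)) as [M HM].
  { intros n Hn. induction Hn as [|n Hn IH]; [lra|].
    eapply Rle_trans; [now apply Hu|exact IH]. }
  exists M. intros n.
  replace (Cmod (alternating_coeff a b n)) with (u n * decay d n).
  - apply Rmult_le_compat_r; [apply Rlt_le, decay_gt_0|apply HM].
  - unfold u, decay. rewrite Rmult_assoc, <- exp_plus, Rplus_opp_r, exp_0. ring.
Qed.

(** 1 - (m-a)(m-b)/((m+a)(m+b)) = 2m(a+b)/((m+a)(m+b)), of order 1/m: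
    consecutive terms nearly cancel. *)
Lemma alternating_pair (a b : C) :
  not_negative_integer a -> not_negative_integer b ->
  exists M, 0 <= M /\ forall n,
    Cmod (alternating_coeff a b n + alternating_coeff a b (S n))%C
    <= M * (Cmod (alternating_coeff a b n) / (INR n + 1)).
Proof.
  intros Ha Hb.
  assert (Hlim : is_lim_seq (fun n => sqr_ratio a n + sqr_ratio b n) (1 + 1)).
  { apply is_lim_seq_plus'; now apply lim_sqr_ratio. }
  apply is_lim_seq_spec in Hlim.
  destruct (Hlim (mkposreal 1 Rlt_0_1)) as [N HN]. simpl in HN.
  destruct (eventually_bounded (fun n => sqr_ratio a n + sqr_ratio b n) N 3) as [M HM].
  { intros n Hn. specialize (HN n Hn). apply Rabs_def2 in HN. lra. }
  exists (Cmod (a + b)%C * Rmax M 0). split.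
  { apply Rmult_le_pos; [apply Cmod_ge_0|apply Rmax_r]. }
  intros n. specialize (HM n).
  pose proof (shift_neq_0 a n Ha) as Hza. pose proof (shift_neq_0 b n Hb) as Hzb.
  pose proof (pos_INR n) as Hn.
  rewrite alternating_S by assumption.
  replace (alternating_coeff a b n + - alternating_coeff a b n
      * ((1 - a + RtoC (INR n)) * (1 - b + RtoC (INR n)))
      / ((1 + a + RtoC (INR n)) * (1 + b + RtoC (INR n))))%C
    with (alternating_coeff a b n * ((a + b) * RtoC (2 * (INR n + 1)))
      / ((1 + a + RtoC (INR n)) * (1 + b + RtoC (INR n))))%C.
  2:{ replace (2 * (INR n + 1)) with ((INR n + 1) + (INR n + 1)) by ring.
      rewrite !RtoC_plus. field. split; assumption. }
  rewrite Cmod_div by now apply Cmult_neq_0.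
  rewrite !Cmod_mult, Cmod_R, Rabs_pos_eq by lra.
  unfold sqr_ratio in HM. apply Cmod_gt_0 in Hza. apply Cmod_gt_0 in Hzb.
  set (xa := Cmod (1 + a + RtoC (INR n))%C) in *.
  set (xb := Cmod (1 + b + RtoC (INR n))%C) in *.
  pose proof (Cmod_ge_0 (alternating_coeff a b n)) as Hw.
  pose proof (Cmod_ge_0 (a + b)%C) as Hc.
  set (v := Cmod (alternating_coeff a b n)) in *. set (c := Cmod (a + b)%C) in *.
  set (k := INR n + 1) in *. assert (Hk : 0 < k) by (unfold k; lra).
  replace (v * (c * (2 * k)) / (xa * xb))
    with (c * (2 * (k / xa) * (k / xb)) * (v / k)) by (field; lra).
  assert (0 <= v / k) by (apply Rdiv_le_0_compat; lra).
  apply Rmult_le_compat_r; [assumption|]. apply Rmult_le_compat_l; [exact Hc|].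
  apply Rle_trans with M; [|apply Rmax_l].
  eapply Rle_trans; [|exact HM].
  replace (k * k / (xa * xa)) with (k / xa * (k / xa)) by (field; lra).
  replace (k * k / (xb * xb)) with (k / xb * (k / xb)) by (field; lra).
  pose proof (Rle_0_sqr (k / xa - k / xb)) as Hs. unfold Rsqr in Hs. lra.
Qed.

Lemma lim_scal_decay (K d : R) : 0 < d -> is_lim_seq (fun n => K * decay d n) 0.
Proof.
  intros Hd. replace (Finite 0) with (Finite (K * 0)) by (f_equal; ring).
  now apply (is_lim_seq_scal_l _ K 0), lim_decay.
Qed.

(** The series of c_r = beta_r + beta_(r+1) converges absolutely by
    [alternating_pair].  If V_r denotes its tails, then (V_r + beta_r) / 2 has
    decrements beta_r, so it gives the tails of the conditionally convergent
    series of the beta_r. *)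
Lemma alternating_tails (a b : C) :
  not_negative_integer a -> not_negative_integer b -> 0 < Re (a + b)%C ->
  exists (T : nat -> C) (M : R),
    (forall r, T r - T (S r) = alternating_coeff a b r)%C
    /\ (forall r, Cmod (T r) <= M * decay (Re (a + b)%C) r).
Proof.
  intros Ha Hb Hab. set (d := Re (a + b)%C) in *.
  destruct (alternating_decay a b Ha Hb Hab) as [M1 H1]. fold d in H1.
  destruct (alternating_pair a b Ha Hb) as [M2 [HM2 H2]].
  set (K := M2 * M1 * (exp d / d)).
  destruct (exists_tails
    (fun r => alternating_coeff a b r + alternating_coeff a b (S r))%C
    (fun r => K * decay d r)) as [V [HV [HVb _]]].
  { intros r. eapply Rle_trans; [apply H2|].
    unfold K. rewrite <- Rmult_minus_distr_l, !Rmult_assoc.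
    apply Rmult_le_compat_l; [exact HM2|].
    assert (HM1 : 0 <= M1).
    { pose proof (H1 O) as H. pose proof (Cmod_ge_0 (alternating_coeff a b O)).
      pose proof (decay_gt_0 d O). apply Rnot_lt_le. intros F. nra. }
    pose proof (pos_INR r).
    apply Rle_trans with (M1 * (decay d r / (INR r + 1))).
    - unfold Rdiv. rewrite <- Rmult_assoc. apply Rmult_le_compat_r; [|apply H1].
      apply Rlt_le, Rinv_0_lt_compat. lra.
    - apply Rmult_le_compat_l; [exact HM1|]. now apply decay_telescope. }
  { now apply lim_scal_decay. }
  exists (fun r => (V r + alternating_coeff a b r) / 2)%C, ((K + M1) / 2). split.
  - intros r.
    replace ((V r + alternating_coeff a b r) / 2
             - (V (S r) + alternating_coeff a b (S r)) / 2)%C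
      with ((V r - V (S r)) / 2
            + (alternating_coeff a b r - alternating_coeff a b (S r)) / 2)%C
      by field.
    rewrite HV. field.
  - intros r. rewrite Cmod_div by (apply RtoC_neq_0; lra).
    rewrite Cmod_R, Rabs_pos_eq by lra.
    apply Rle_div_l; [lra|].
    eapply Rle_trans; [apply Cmod_triangle|].
    specialize (HVb r). specialize (H1 r). lra.
Qed.

(** The majorant for [lim_sum_kernel_transform]: half of the decay rate of the
    tail z pays for the harmonic number in the increment x, and the other half is
    summed by [decay_telescope]. *)
Lemma harmonic_decay_telescope (M d : R) (r : nat) (z : C) (x : R) :
  0 < d -> 0 <= x <= 40 * ((1 + harmonic r) / (INR r + 1)) ->
  Cmod z <= M * decay d (S r) ->
  Cmod z * x <= M * (40 * (1 + 2 / d) * (exp (d / 2) / (d / 2))) * decay (d / 2) r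
    - M * (40 * (1 + 2 / d) * (exp (d / 2) / (d / 2))) * decay (d / 2) (S r).
Proof.
  intros Hd Hx Hz.
  assert (HM : 0 <= M).
  { pose proof (Cmod_ge_0 z). pose proof (decay_gt_0 d (S r)).
    apply Rnot_lt_le. intros F. nra. }
  pose proof (pos_INR r) as Hr.
  assert (Hi : 0 < / (INR r + 1)) by (apply Rinv_0_lt_compat; lra).
  pose proof (harmonic_ge_0 r) as Hh.
  assert (Hdec : decay d (S r) <= decay d r).
  { unfold decay. rewrite harmonic_S. apply Rnot_lt_le. intros F.
    apply exp_lt_inv in F. nra. }
  pose proof (harmonic_decay d r Hd) as H1.
  pose proof (decay_telescope (d / 2) r ltac:(lra)) as H2.
  assert (H3 : 0 < 2 / d) by (apply Rdiv_lt_0_compat; lra).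
  apply Rle_trans with
    (M * decay d r * (40 * ((1 + harmonic r) / (INR r + 1)))).
  - apply Rmult_le_compat; [apply Cmod_ge_0|lra| |lra].
    eapply Rle_trans; [exact Hz|]. now apply Rmult_le_compat_l.
  - replace (M * decay d r * (40 * ((1 + harmonic r) / (INR r + 1))))
      with (M * (40 * ((1 + harmonic r) * decay d r * / (INR r + 1))))
      by (unfold Rdiv; ring).
    rewrite <- Rmult_minus_distr_l, !Rmult_assoc.
    apply Rmult_le_compat_l; [exact HM|]. apply Rmult_le_compat_l; [lra|].
    apply Rle_trans with ((1 + 2 / d) * (decay (d / 2) r / (INR r + 1))).
    + unfold Rdiv at 2. rewrite <- !Rmult_assoc.
      apply Rmult_le_compat_r; [lra|exact H1].
    + apply Rmult_le_compat_l; [lra|exact H2].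
Qed.

(** * The harmonic summation *)

(** With f(r) = 2, constant in r, the transform gives sum A_n = 2 T_0.  With
    f(r) = 4 H_r, so that f(0) = 0, it gives
    sum A_n (H_n - ln 4) = 4 sum_r T_(r+1) (H_(r+1) - H_r), which one more
    summation by parts turns into 4 sum_r beta_r H_r. *)
Lemma harmonic_summation (a b : C) :
  not_negative_integer a -> not_negative_integer b -> 0 < Re (a + b)%C ->
  exists s t : C,
    Cconv (sum_n (hyp_coeff a b)) s
    /\ Cconv (sum_n (fun n => alternating_coeff a b n * RtoC (harmonic n))%C) t
    /\ Cconv (sum_n (fun n => hyp_coeff a b n * RtoC (harmonic n))%C)
         (RtoC 4 * t + s * RtoC (ln 4))%C.
Proof.
  intros Ha Hb Hab.
  destruct (alternating_tails a b Ha Hb Hab) as [T [M [HT HM]]].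
  set (d := Re (a + b)%C) in *.
  assert (Hd2 : 0 < d / 2) by lra.
  set (K := M * (40 * (1 + 2 / d) * (exp (d / 2) / (d / 2)))).
  set (m := fun r => K * decay (d / 2) r).
  assert (Hm0 : is_lim_seq m 0) by now apply lim_scal_decay.
  assert (Hmaj : forall r x, 0 <= x <= 40 * ((1 + harmonic r) / (INR r + 1)) ->
            Cmod (T (S r)) * x <= m r - m (S r)).
  { intros r x Hx. apply harmonic_decay_telescope; [exact Hab|exact Hx|apply HM]. }
  assert (Hplain : Cconv (sum_n (hyp_coeff a b)) (T O * RtoC 2)%C).
  { apply Cconv_ext with
      (sum_n (fun n => kernel_transform (alternating_coeff a b) n * RtoC 1)%C).
    { intros n. apply sum_n_ext. intros k.
      rewrite <- hyp_coeff_kernel_transform by assumption. apply Cmult_1_r. }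
    replace (T O * RtoC 2)%C with (T O * RtoC 2 + RtoC 0)%C by ring.
    apply lim_sum_kernel_transform with (f := fun _ => 2) (m := m)
      (w := fun _ => 1); try assumption.
    - intros N r. apply Hmaj. split; [apply Rabs_pos|apply plain_sum_step_bound].
    - apply lim_plain_sum.
    - apply Cconv_ext with (fun _ => RtoC 0); [|apply Cconv_const].
      intros n. induction n as [|n IH].
      + rewrite sum_O, Rminus_diag. ring.
      + rewrite sum_SnC, <- IH, Rminus_diag. ring. }
  set (y := fun r => (T (S r) * RtoC (4 * harmonic (S r) - 4 * harmonic r))%C).
  destruct (exists_tails y m) as [V [_ [_ HL]]]; [|exact Hm0|].
  { intros r. unfold y. rewrite Cmod_mult, Cmod_R. apply Hmaj.
    split; [apply Rabs_pos|]. rewrite harmonic_S.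
    pose proof (pos_INR r). pose proof (harmonic_ge_0 r).
    assert (Hi : 0 < / (INR r + 1)) by (apply Rinv_0_lt_compat; lra).
    assert (0 <= harmonic r * / (INR r + 1)) by (apply Rmult_le_pos; lra).
    unfold Rdiv. apply Rabs_le. lra. }
  set (L := V O) in *.
  assert (Hshift : Cconv
    (sum_n (fun n =>
       kernel_transform (alternating_coeff a b) n * RtoC (shifted_harmonic n))%C)
    (T O * RtoC (4 * harmonic O) + L)%C).
  { apply lim_sum_kernel_transform with (f := fun r => 4 * harmonic r) (m := m);
      try assumption.
    - intros N r. apply Hmaj. split; [apply Rabs_pos|apply harmonic_sum_step_bound].
    - apply lim_harmonic_sum. }
  exists (T O * RtoC 2)%C, (/ 4 * L)%C. split; [exact Hplain|]. split.
  (* The boundary term T_(n+1) H_(n+1) vanishes because half of the decay rate of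
     T absorbs the harmonic number. *)
  - apply Cconv_ext with (fun n => (/ 4 * sum_n y n)
      + - (1) * (T (S n) * RtoC (harmonic (S n))))%C.
    { intros n. rewrite (sum_by_parts T _ harmonic n HT), harmonic_0.
      assert (E : sum_n y n
        = (4 * sum_n (fun r =>
                 T (S r) * RtoC (harmonic (S r) - harmonic r))%C n)%C :> C).
      { unfold y. clear. induction n as [|n IH].
        - rewrite !sum_O, <- Rmult_minus_distr_l, RtoC_mult. ring.
        - rewrite !sum_SnC, IH, <- Rmult_minus_distr_l, RtoC_mult. ring. }
      rewrite E. field. }
    replace (/ 4 * L)%C with (/ 4 * L + - (1) * 0)%C by ring.
    apply Cconv_plus; [now apply Cconv_scal|]. apply Cconv_scal.
    apply Cconv_squeeze with (fun n => M * (1 + 2 / d) * decay (d / 2) (S n)).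
    + intros n. replace (T (S n) * RtoC (harmonic (S n)) - 0)%C
        with (T (S n) * RtoC (harmonic (S n)))%C by ring.
      pose proof (harmonic_ge_0 (S n)) as Hh.
      rewrite Cmod_mult, Cmod_R, Rabs_pos_eq by exact Hh.
      specialize (HM (S n)). pose proof (harmonic_decay d (S n) Hab) as H.
      pose proof (decay_gt_0 d (S n)) as He. pose proof (Cmod_ge_0 (T (S n))) as HT0.
      assert (HM0 : 0 <= M) by (apply Rnot_lt_le; intros F; nra).
      apply Rle_trans with (M * decay d (S n) * harmonic (S n)).
      * now apply Rmult_le_compat_r.
      * rewrite !Rmult_assoc. apply Rmult_le_compat_l; [exact HM0|]. lra.
    + apply (is_lim_seq_incr_1 (fun n => M * (1 + 2 / d) * decay (d / 2) n)).
      now apply lim_scal_decay.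
  - apply Cconv_ext with (fun n =>
      sum_n (fun n =>
        kernel_transform (alternating_coeff a b) n * RtoC (shifted_harmonic n))%C n
      + RtoC (ln 4) * sum_n (hyp_coeff a b) n)%C.
    { intros n. induction n as [|n IH].
      - rewrite !sum_O, <- hyp_coeff_kernel_transform by assumption.
        unfold shifted_harmonic. rewrite RtoC_minus. ring.
      - rewrite !sum_SnC, <- IH, <- hyp_coeff_kernel_transform by assumption.
        unfold shifted_harmonic. rewrite RtoC_minus. ring. }
    replace (RtoC 4 * (/ 4 * L) + T O * RtoC 2 * RtoC (ln 4))%C
      with ((T O * RtoC (4 * harmonic O) + L) + RtoC (ln 4) * (T O * RtoC 2))%C.
    + apply Cconv_plus; [exact Hshift|]. now apply Cconv_scal.
    + rewrite harmonic_0, Rmult_0_r. field.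
Qed.

Lemma pochhammer_1 (n : nat) : pochhammer (RtoC 1) n = RtoC (INR (fact n)).
Proof.
  induction n as [|n IH]; [reflexivity|].
  change (fact (S n)) with (S n * fact n)%nat.
  rewrite mult_INR, RtoC_mult, <- IH, S_INR, RtoC_plus. simpl. ring.
Qed.

Lemma hyp3F2_term_hyp_coeff (a b : C) (n : nat) :
  not_negative_integer a -> not_negative_integer b ->
  hyp_coeff a b n
  = hyp3F2_term (RtoC 1) (RtoC (1 / 2)) (a + b)%C (1 + a)%C (1 + b)%C (RtoC 1) n.
Proof.
  intros Ha Hb. unfold hyp3F2_term, hyp_coeff.
  rewrite Cpow_1_l, pochhammer_1. field.
  repeat split; try now apply pochhammer_neq_0.
  apply RtoC_neq_0, INR_fact_neq_0.
Qed.

Theorem theorem4 (a b : C)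
  (ha : forall k : nat, a <> RtoC (- INR (S k)))
  (hb : forall k : nat, b <> RtoC (- INR (S k)))
  (hab : (0 < Re (a + b)%C)%R) :
  ex_Cseries (fun n => lhs_term a b (S n)) /\
  ex_Cseries (fun n => rhs_term a b (S n)) /\
  ex_Cseries (hyp3F2_term (RtoC 1) (RtoC (1 / 2)) (a + b)%C
                (1 + a)%C (1 + b)%C (RtoC 1)) /\
  CSeries (fun n => lhs_term a b (S n)) =
  (RtoC 4 * CSeries (fun n => rhs_term a b (S n))
   + hyp3F2 (RtoC 1) (RtoC (1 / 2)) (a + b) (1 + a) (1 + b) (RtoC 1)
     * RtoC (ln 4))%C.
Proof.
  destruct (harmonic_summation a b ha hb hab) as [s [t [Hs [Ht Hst]]]].
  apply Cconv_sum_shift in Ht; [|rewrite harmonic_0; ring].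
  apply Cconv_sum_shift in Hst; [|rewrite harmonic_0; ring].
  apply Cconv_series in Ht as [Ht Ht']. apply Cconv_series in Hst as [Hst Hst'].
  assert (Hs2 : Cconv (sum_n (hyp3F2_term (RtoC 1) (RtoC (1 / 2)) (a + b)%C
                (1 + a)%C (1 + b)%C (RtoC 1))) s).
  { apply Cconv_ext with (sum_n (hyp_coeff a b)); [|exact Hs].
    intros n. apply sum_n_ext. intros k. now apply hyp3F2_term_hyp_coeff. }
  apply Cconv_series in Hs2 as [Hs2 Hs2'].
  split; [exact Hst|]. split; [exact Ht|]. split; [exact Hs2|].
  unfold hyp3F2. rewrite Hs2'.
  transitivity (RtoC 4 * t + s * RtoC (ln 4))%C; [exact Hst'|].
  rewrite <- Ht'. reflexivity.
Qed.
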